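(* Let $d \ge 2$ and $k$ be integers with $1 \le k \le d-1$, put $N = 2d-k+1$ and $m(k,d) = \max\{d+1,\, 2(d-k+1)\}$. Let $\mathcal F_1, \dots, \mathcal F_N$ be finite families of convex sets in $\mathbb{R}^d$. Suppose that the intersection of every rainbow sub-selection of at most $m(k,d)$ sets from $\mathcal F_1,\dots,\mathcal F_N$ contains a $k$-dimensional cone. Then, for some $i \in \{1,\dots,N\}$, the intersection $$\bigcap_{F \in \mathcal F_i} F$$ contains a $k$-dimensional cone.
   Context: For $A \subset \mathbb{R}^d$, $\operatorname{Pos} A$ denotes its positive hull, i.e. the set of all finite linear combinations of elements of $A$ with non-negative coefficients (containing the origin). A (convex) cone is a set of the form $a + \operatorname{Pos} A$ with $a \in \mathbb{R}^d$ and $A \subset \mathbb{R}^d$; the apex $a$ need not be the origin. Its dimension is the dimension of the linear span of $A$ (equivalently, of its affine hull). A rainbow sub-selection from $\mathcal F_1,\dots,\mathcal F_N$ consists of at most one set from each family: a choice of a set of indices $J \subset \{1,\dots,N\}$ and of one set $F_j \in \mathcal F_j$ for each $j \in J$; it has at most $m(k,d)$ sets if $|J| \le m(k,d)$, and its intersection is $\bigcap_{j \in J} F_j$. The intersection of an empty collection is $\mathbb{R}^d$. *)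

(* Defs.v *)
From mathcomp Require Import all_boot all_order all_algebra.
From mathcomp Require Import all_classical all_reals convex.

Set Implicit Arguments.
Unset Strict Implicit.
Unset Printing Implicit Defensive.

Import Order.TTheory GRing.Theory Num.Theory.

Local Open Scope classical_set_scope.
Local Open Scope ring_scope.

(* n = 0 gives the origin, also when A is empty *)
Definition pos_hull (R : realType) (V : vectType R) (A : set V) : set V :=
  [set x | exists (n : nat) (c : 'I_n -> R) (v : 'I_n -> V),
     [/\ forall i, 0 <= c i, forall i, A (v i) & x = \sum_(i < n) c i *: v i]].

Definition lin_hull (R : realType) (V : vectType R) (A : set V) : set V :=
  [set x | exists (n : nat) (c : 'I_n -> R) (v : 'I_n -> V),
     (forall i, A (v i)) /\ x = \sum_(i < n) c i *: v i].

(* {vspace V} only offers spans of finite sequences, while A may be infinite;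
   the subspace U below is unique. *)
Definition span_has_dim (R : realType) (V : vectType R) (A : set V) (k : nat) :
    Prop :=
  exists2 U : {vspace V}, [set` U] = lin_hull A & \dim U = k.

Definition cone_of_dim (R : realType) (V : vectType R) (k : nat) (C : set V) :
    Prop :=
  exists (a : V) (A : set V),
    C = [set a + x | x in pos_hull A] /\ span_has_dim A k.

Definition contains_cone (R : realType) (V : vectType R) (k : nat) (S : set V) :
    Prop :=
  exists2 C : set V, cone_of_dim k C & C `<=` S.

(* Main.v *)
(* Put [r = d - k + 1].  A closed convex set contains no [k]-dimensional cone iff
   it is empty or [r] independent linear functionals vanish on its recession
   cone; for an intersection this says that some normals of the sets either
   certify emptiness or are positively dependent with a span of dimension at
   least [r].

   Rainbows of arbitrary size.  Assume that every full rainbow contains a cone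
   and replace each set by the convex hull of the chosen cones that it contains.
   If the hulls of some rainbow have no common relative interior point, a
   minimal positive dependence among supporting functionals confines [w + 1] of
   its sets to a flat of codimension [w >= 1]; the remaining colours, restricted
   to that flat, are handled by induction on [d].  Otherwise the hulls can be
   closed up, and each family without a cone has a finite certificate.  Among
   the rainbow sets [J] of normals that positively span some [W] with
   [#|J| <= 2 * dim W], take [dim W] maximal and then [J] as near as possible to
   certifying emptiness.  If [dim W < r], each colour outside [J] has a positive
   dependence leaving [W], and there are more than [d - dim W] such colours as
   there are [d + r] in all; colourful Caratheodory modulo [W] enlarges [W].

   From arbitrary rainbows to at most [max (d + 1) (2 r)] sets (Katchalski's
   theorem).  In a minimal family of [n > 2 r] convex sets whose intersection
   contains no cone, one has [n <= d + 1], and the intersection does not even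
   contain a cone of dimension [d + 2 - n]; this stronger claim is proved by
   induction on [d], again by passing to the flat of a positive dependence. *)
Require Import Defs.
From mathcomp Require Import all_boot all_order all_algebra.
From mathcomp Require Import all_classical all_reals convex.
From mathcomp Require Import interval_inference ring lra zify.
From mathcomp Require Import fintype finset.

Set Implicit Arguments.
Unset Strict Implicit.
Unset Printing Implicit Defensive.

Import Order.TTheory GRing.Theory Num.Theory.

Local Open Scope ring_scope.

(** * Projection onto finitely generated cones *)

Section InnerProduct.
Context (R : realFieldType) (V : lmodType R) (dot : V -> V -> R).
Hypothesis dotC : forall x y, dot x y = dot y x.
Hypothesis dotDl : forall x y z, dot (x + y) z = dot x z + dot y z.
Hypothesis dotZl : forall a x y, dot (a *: x) y = a * dot x y.
Hypothesis dot_ge0 : forall x, 0 <= dot x x.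
Hypothesis dot_eq0 : forall x, dot x x = 0 -> x = 0.

Let dot0l x : dot 0 x = 0.
Proof. by rewrite -(scale0r 0) dotZl mul0r. Qed.
Let dotNl x y : dot (- x) y = - dot x y.
Proof. by rewrite -scaleN1r dotZl mulN1r. Qed.
Let dotBl x y z : dot (x - y) z = dot x z - dot y z.
Proof. by rewrite dotDl dotNl. Qed.
Let dotDr x y z : dot z (x + y) = dot z x + dot z y.
Proof. by rewrite dotC dotDl !(dotC _ z). Qed.
Let dotZr a x y : dot y (a *: x) = a * dot y x.
Proof. by rewrite dotC dotZl dotC. Qed.
Let dotBr x y z : dot z (x - y) = dot z x - dot z y.
Proof. by rewrite dotC dotBl !(dotC _ z). Qed.
Let dot_suml (T : finType) (A : {set T}) (s : T -> V) y :
  dot (\sum_(t in A) s t) y = \sum_(t in A) dot (s t) y.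
Proof. by apply: (big_morph (dot^~ y)) => // x z; rewrite dotDl. Qed.

(* Induction on the number of generators: if the projection for the other
   generators is not optimal for [x], project everything along [x]. *)
Lemma cone_projection (T : finType) (A : {set T}) (s : T -> V) (p : V) :
  exists lam : T -> R, (forall t, 0 <= lam t) /\
    let q := \sum_(t in A) lam t *: s t in
    (forall t, t \in A -> dot (p - q) (s t) <= 0) /\ dot (p - q) q = 0.
Proof.
have [n] := ubnP #|A|; elim: n => // n IH in A s p * => /ltnSE-leAn.
have [->|[x xA]] := set_0Vmem A.
  exists (fun=> 0); split=> //=; rewrite big_set0; split=> [t|].
    by rewrite inE.
  by rewrite dotC dot0l.
have ltA' : (#|A :\ x| < n)%N by move: leAn; rewrite (cardsD1 x) xA.
have [lam1 [lam1_ge0 /=]] := IH (A :\ x) s p ltA'.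
set q1 := \sum_(t in _) _ => -[z1s z1q].
have [z1x|z1x] := leP (dot (p - q1) (s x)) 0.
  exists (fun t => if t == x then 0 else lam1 t); split=> [t|/=].
    by case: ifP.
  have -> : \sum_(t in A) (if t == x then 0 else lam1 t) *: s t = q1.
    rewrite (big_setD1 x)//= eqxx scale0r add0r; apply: eq_bigr => t.
    by rewrite !inE => /andP[/negPf->].
  split=> // t tA; have [->//|tx] := eqVneq t x.
  by apply: z1s; rewrite !inE tx.
have n_gt0 : 0 < dot (s x) (s x).
  rewrite lt_def dot_ge0 andbT; apply: contraTneq z1x => /dot_eq0 ->.
  by rewrite dotC dot0l ltxx.
set N := dot (s x) (s x) in n_gt0.
pose pr v := v - (dot v (s x) / N) *: s x.
have [lam [lam_ge0 /=]] := IH (A :\ x) (pr \o s) (pr p) ltA'.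
set z := pr p - _; rewrite /= => -[zs zq].
pose h := \sum_(t in A :\ x) lam t *: s t.
pose tau := (dot p (s x) - dot h (s x)) / N.
have prx v : dot (pr v) (s x) = 0.
  by rewrite /pr dotBl dotZl -/N divfK ?subrr// gt_eqF.
have prh : \sum_(t in A :\ x) lam t *: pr (s t) = pr h.
  rewrite /pr -[RHS]/(h - _) /h dot_suml mulr_suml scaler_suml -sumrB.
  by apply: eq_bigr => t _; rewrite scalerBr scalerA dotZl mulrA.
have zE : z = p - (tau *: s x + h).
  rewrite /z prh /pr /tau mulrBl scalerBl.
  set a := _ *: s x; set b := _ *: s x.
  by rewrite -addrA -opprD; congr (p - _); rewrite addrCA addrC.
have zx : dot z (s x) = 0 by rewrite /z prh dotBl !prx subrr.
have zpr v : dot z (pr v) = dot z v by rewrite /pr dotBr dotZr zx mulr0 subr0.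
have zh : dot z h = 0 by rewrite -zpr -prh.
clear prh; clearbody z.
(* If [tau] were negative, the product inequalities of the residuals [p - q1] and [z] would add up
   to a negative squared distance between the two approximations of [p]. *)
have tau_ge0 : 0 <= tau.
  rewrite leNgt; apply/negP => tau_lt0.
  suff : dot (q1 - (tau *: s x + h)) (q1 - (tau *: s x + h)) < 0.
    by rewrite ltNge dot_ge0.
  have -> : dot (q1 - (tau *: s x + h)) (q1 - (tau *: s x + h)) =
      dot (z - (p - q1)) (q1 - (tau *: s x + h)).
    congr (dot _ _); rewrite zE opprB [RHS]addrC addrA subrK.
    by rewrite addrC.
  have zq1 : dot z q1 <= 0.
    rewrite dotC dot_suml; apply: sumr_le0 => t tA.
    by rewrite dotZl mulr_ge0_le0// dotC -zpr zs.
  have z1h : dot (p - q1) h <= 0.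
    rewrite dotC dot_suml; apply: sumr_le0 => t tA.
    by rewrite dotZl mulr_ge0_le0// dotC z1s.
  have : tau * dot (p - q1) (s x) < 0 by rewrite nmulr_rlt0.
  rewrite (dotBl z) !dotBr !dotDr !dotZr zx zh.
  move: zq1 z1h z1q; lra.
exists (fun t => if t == x then tau else lam t); split=> [t|/=].
  by case: ifP.
have -> : \sum_(t in A) (if t == x then tau else lam t) *: s t =
    tau *: s x + h.
  rewrite (big_setD1 x)//= eqxx; congr (_ + _); apply: eq_bigr => t.
  by rewrite !inE => /andP[/negPf->].
rewrite -zE dotDr dotZr zx zh mulr0 addr0; split=> // t tA.
have [->|tx] := eqVneq t x; first by rewrite zx.
by rewrite -zpr zs// !inE tx.
Qed.

(** The residual of the projection of [p] onto the cone is the separating vector: being orthogonal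
    to the projection, it has product [dot z z] with [p]. *)
Lemma cone_farkas (T : finType) (s : T -> V) (p : V) :
  (exists2 lam : T -> R, forall t, 0 <= lam t & p = \sum_t lam t *: s t) \/
  (exists2 z, forall t, dot z (s t) <= 0 & 0 < dot z p).
Proof.
have [lam [lam_ge0 /=]] := cone_projection [set: T] s p.
set q := \sum_(t in _) _ => -[zs zq].
have [z0|z0] := eqVneq (p - q) 0.
  left; exists lam => //; move/subr0_eq: z0 ->.
  by apply: eq_bigl => t; rewrite inE.
right; exists (p - q) => [t|]; first exact: zs.
rewrite -[in X in dot _ X](subrK q p) dotDr zq addr0 lt_def dot_ge0 andbT.
by apply: contraNneq z0 => /dot_eq0 ->.
Qed.

(* Moving from the nearest point towards a generator on the good side gets
   strictly closer. *)
Lemma cone_improve (z h : V) :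
  0 < dot z h -> exists2 e, 0 < e & dot (z - e *: h) (z - e *: h) < dot z z.
Proof.
move=> zh; have h_gt0 : 0 < dot h h.
  rewrite lt_def dot_ge0 andbT; apply: contraTneq zh => /dot_eq0 ->.
  by rewrite dotC dot0l ltxx.
exists (dot z h / dot h h); first exact: divr_gt0.
rewrite dotBl !dotBr !dotZl !dotZr (dotC h z).
set a := dot z h in zh *; set b := dot h h in h_gt0 *.
have -> : a / b * (a / b * b) = a / b * a by rewrite divfK// gt_eqF.
have : 0 < a / b * a by rewrite mulr_gt0// divr_gt0.
lra.
Qed.

(** With [q] the sum, [dot z (p - q) >= dot z z]; expanding the square of [z - (p - q)] gives the
    bound. *)
Lemma cone_optimal (T : finType) (A : {set T}) (s : T -> V) (p z : V)
    (mu : T -> R) :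
  (forall t, t \in A -> dot z (s t) <= 0) -> dot z p = dot z z ->
  (forall t, t \in A -> 0 <= mu t) ->
  dot z z <= dot (p - \sum_(t in A) mu t *: s t)
                 (p - \sum_(t in A) mu t *: s t).
Proof.
move=> zs zp mu_ge0; set q := \sum_(t in A) _.
have zq : dot z q <= 0.
  rewrite dotC dot_suml; apply: sumr_le0 => t tA.
  by rewrite dotZl mulr_ge0_le0 ?mu_ge0// dotC zs.
have := dot_ge0 (z - (p - q)); rewrite dotBl [dot z (_ - _)]dotBr.
rewrite [dot (p - q) _]dotBr (dotC (p - q) z) (dotBr _ q z) zp; lra.
Qed.

End InnerProduct.

(** * The standard inner product and a Farkas lemma with several blocks *)

Section Dot.
Context (R : realFieldType).

Definition dot n (x y : 'rV[R]_n) : R := (x *m y^T) 0 0.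

Lemma dotE n (x y : 'rV[R]_n) : dot x y = \sum_j x 0 j * y 0 j.
Proof. by rewrite /dot mxE; apply: eq_bigr => j _; rewrite mxE. Qed.

Lemma dotC n (x y : 'rV[R]_n) : dot x y = dot y x.
Proof. by rewrite !dotE; apply: eq_bigr => j _; rewrite mulrC. Qed.

Lemma dotDl n (x y z : 'rV[R]_n) : dot (x + y) z = dot x z + dot y z.
Proof. by rewrite /dot mulmxDl mxE. Qed.

Lemma dotZl n a (x y : 'rV[R]_n) : dot (a *: x) y = a * dot x y.
Proof. by rewrite /dot -scalemxAl mxE. Qed.

Lemma dotDr n (x y z : 'rV[R]_n) : dot z (x + y) = dot z x + dot z y.
Proof. by rewrite dotC dotDl !(dotC z). Qed.

Lemma dotZr n a (x y : 'rV[R]_n) : dot y (a *: x) = a * dot y x.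
Proof. by rewrite dotC dotZl dotC. Qed.

Lemma dot0l n (x : 'rV[R]_n) : dot 0 x = 0.
Proof. by rewrite /dot mul0mx mxE. Qed.

Lemma dot0r n (x : 'rV[R]_n) : dot x 0 = 0.
Proof. by rewrite dotC dot0l. Qed.

Lemma dotNl n (x y : 'rV[R]_n) : dot (- x) y = - dot x y.
Proof. by rewrite /dot mulNmx mxE. Qed.

Lemma dotNr n (x y : 'rV[R]_n) : dot x (- y) = - dot x y.
Proof. by rewrite dotC dotNl dotC. Qed.

Lemma dotBr n (x y z : 'rV[R]_n) : dot z (x - y) = dot z x - dot z y.
Proof. by rewrite dotDr dotNr. Qed.

Lemma dot_suml n (T : finType) (P : pred T) (s : T -> 'rV[R]_n) y :
  dot (\sum_(t | P t) s t) y = \sum_(t | P t) dot (s t) y.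
Proof. by apply: (big_morph (@dot n^~ y)) => [x z|]; rewrite ?dotDl ?dot0l. Qed.

Lemma dot_sumr n (T : finType) (P : pred T) (s : T -> 'rV[R]_n) y :
  dot y (\sum_(t | P t) s t) = \sum_(t | P t) dot y (s t).
Proof. by rewrite dotC dot_suml; apply: eq_bigr => t _; rewrite dotC. Qed.

Lemma dot_ge0 n (x : 'rV[R]_n) : 0 <= dot x x.
Proof. by rewrite dotE; apply: sumr_ge0 => j _; rewrite -expr2 sqr_ge0. Qed.

Lemma dot_eq0 n (x : 'rV[R]_n) : dot x x = 0 -> x = 0.
Proof.
move/eqP; rewrite dotE psumr_eq0 => [/allP x0|j _]; last exact: sqr_ge0.
apply/rowP => j; rewrite mxE; have := x0 j (mem_index_enum _).
by rewrite mulf_eq0 orbb => /eqP.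
Qed.

Lemma dot_row_mx n m (x : 'rV[R]_n) (y : 'rV_m) x' y' :
  dot (row_mx x y) (row_mx x' y') = dot x x' + dot y y'.
Proof. by rewrite /dot tr_row_mx mul_row_col mxE. Qed.

Lemma dotP n (x y : 'rV[R]_n) : (forall z, dot x z = dot y z) -> x = y.
Proof.
move=> xy; apply/eqP; rewrite -subr_eq0; apply/eqP/dot_eq0.
by rewrite dotDl dotNl xy subrr.
Qed.

Definition fdot (K : finType) n (x y : {ffun K -> 'rV[R]_n}) : R :=
  \sum_k dot (x k) (y k).

(* The unknowns are a common point [y *m D] and, for each block [i], a
   nonnegative combination of the generators [g i]. *)
Lemma block_farkas (J F : finType) (A : {set J}) n q
    (g : J -> F -> 'rV[R]_n) (D : 'M_(q, n)) (tau : J -> 'rV_n) :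
  (exists (y : 'rV_q) (co : J -> F -> R), (forall i f, 0 <= co i f) /\
     forall i, i \in A -> \sum_f co i f *: g i f = y *m D + tau i) \/
  (exists Psi : J -> 'rV_n,
     [/\ forall i f, i \in A -> dot (Psi i) (g i f) <= 0,
         forall y, dot (\sum_(i in A) Psi i) (y *m D) = 0 &
         0 < \sum_(i in A) dot (Psi i) (tau i)]).
Proof.
pose s (e : J * F + 'I_q * bool) : {ffun J -> 'rV[R]_n} :=
  match e with
  | inl (i, f) => [ffun j => if (j == i) && (i \in A) then g i f else 0]
  | inr (c, b) => [ffun j => if j \in A then (-1) ^+ b *: row c D else 0]
  end.
pose p : {ffun J -> 'rV[R]_n} := [ffun j => if j \in A then tau j else 0].
have fC (x y : {ffun J -> 'rV[R]_n}) : fdot x y = fdot y x.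
  by apply: eq_bigr => k _; rewrite dotC.
have fD (x y z : {ffun J -> 'rV[R]_n}) : fdot (x + y) z = fdot x z + fdot y z.
  by rewrite -big_split; apply: eq_bigr => k _; rewrite ffunE dotDl.
have fZ a (x y : {ffun J -> 'rV[R]_n}) : fdot (a *: x) y = a * fdot x y.
  by rewrite /fdot mulr_sumr; apply: eq_bigr => k _; rewrite ffunE dotZl.
have f_ge0 (x : {ffun J -> 'rV[R]_n}) : 0 <= fdot x x.
  by apply: sumr_ge0 => k _; apply: dot_ge0.
have f_eq0 (x : {ffun J -> 'rV[R]_n}) : fdot x x = 0 -> x = 0.
  move=> /eqP; rewrite /fdot psumr_eq0 => [/allP x0|k _]; last exact: dot_ge0.
  apply/ffunP => k; rewrite ffunE; apply: dot_eq0.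
  exact/eqP/x0/mem_index_enum.
have [[lam lam_ge0 pE]|[z zs zp]] := cone_farkas fC fD fZ f_ge0 f_eq0 s p.
  left; exists (\row_c (lam (inr (c, true)) - lam (inr (c, false)))).
  exists (fun i f => lam (inl (i, f))); split=> // i iA.
  move/ffunP/(_ i): pE; rewrite ffunE iA => ->.
  rewrite sum_ffunE big_sumType /= [X in _ = _ + (X + _)](_ : _ =
      \sum_f lam (inl (i, f)) *: g i f); last first.
    rewrite (eq_bigr (fun e => lam (inl (e.1, e.2)) *:
      (if (i == e.1) && (e.1 \in A) then g e.1 e.2 else 0))); last first.
      by case=> j f _ /=; rewrite !ffunE.
    rewrite -(pair_bigA _ (fun j f => lam (inl (j, f)) *:
      (if (i == j) && (j \in A) then g j f else 0))) /=.
    rewrite (bigD1 i)//= [X in _ + X]big1 ?addr0 => [|j ji].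
      by apply: eq_bigr => f _; rewrite eqxx iA.
    by apply: big1 => f _; rewrite eq_sym (negPf ji) scaler0.
  rewrite addrCA -[LHS]addr0; congr (_ + _); apply/esym.
  rewrite (eq_bigr (fun e => lam (inr (e.1, e.2)) *:
      ((-1) ^+ e.2 *: row e.1 D))); last first.
    by case=> c b _ /=; rewrite !ffunE iA.
  rewrite -(pair_bigA _ (fun c b => lam (inr (c, b)) *:
      ((-1) ^+ (b : bool) *: row c D))) /= mulmx_sum_row -big_split /=.
  apply: big1 => c _; rewrite big_bool /= !mxE expr1 expr0 !scalerA mulrN1 mulr1.
  by rewrite -!scalerDl -[RHS](scale0r (row c D)); congr (_ *: _); ring.
right; exists z; split=> [i f iA||].
- have := zs (inl (i, f)); rewrite /fdot (bigD1 i)//= ffunE eqxx iA big1 ?addr0//.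
  by move=> j ji; rewrite ffunE (negPf ji) dot0r.
- have zr c : dot (\sum_(i in A) z i) (row c D) = 0.
    have zb b : (-1) ^+ (b : bool) * dot (\sum_(i in A) z i) (row c D) <= 0.
      have := zs (inr (c, b)); rewrite /fdot dot_suml mulr_sumr.
      rewrite (bigID (mem A)) /= [X in _ + X]big1 ?addr0.
        by under eq_bigr => i iA do rewrite ffunE iA dotZr.
      by move=> j /negPf jA; rewrite ffunE jA dot0r.
    have := zb true; have := zb false; rewrite expr0 expr1; lra.
  move=> y; rewrite mulmx_sum_row dot_sumr big1// => c _.
  by rewrite dotZr zr mulr0.
- move: zp; rewrite /fdot (bigID (mem A)) /= [X in _ + X]big1 ?addr0.
    by under eq_bigr => i iA do rewrite ffunE iA.
  by move=> j /negPf jA; rewrite ffunE jA dot0r.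
Qed.

End Dot.

(** * Positive dependences *)

(** Rows taken from [X] with the largest possible rank already span [X]: appending a further vector
    cannot raise the rank. *)
Lemma spanning_rows (R : fieldType) (d : nat) (X : 'rV[R]_d -> Prop) :
  exists m (M : 'M[R]_(m, d)),
    (forall l, X (row l M)) /\ forall v, X v -> (v <= M)%MS.
Proof.
pose P n := `[< exists m (M : 'M[R]_(m, d)), \rank M = n /\
   forall l, X (row l M) >].
have exP : exists n, P n.
  by exists 0%N; apply/asboolP; exists 0%N, 0; split; [exact: mxrank0|case].
have ubP n : P n -> (n <= d)%N.
  by move=> /asboolP[m [M [<- _]]]; apply: rank_leq_col.
have [rho /asboolP[m [M [rM XM]]] maxrho] := ex_maxnP exP ubP.
exists m, M; split=> // v Xv.
have /maxrho : P (\rank (col_mx M v)).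
  apply/asboolP; exists (m + 1)%N, (col_mx M v); split=> // l.
  by case: (split_ordP l) => i ->; rewrite ?rowKu// rowKd [row _ _]row_id.
rewrite -rM => le_rk; have [_ /esym] := mxrank_leqif_sup (addsmxSl M v).
rewrite (_ : _ == _ = true) => [MvM|].
  by apply: submx_trans MvM; apply: addsmxSr.
by apply/eqP/anti_leq; rewrite mxrankS ?addsmxSl//= addsmxE.
Qed.

Section PositiveDependence.
Context (R : realFieldType) (T : finType) (n : nat).
Implicit Types (A B : {set T}) (x : T -> 'rV[R]_n).

Definition spanm A x : 'M[R]_n := (\sum_(t in A) <<x t>>)%MS.

Definition indep A x :=
  forall th : T -> R, \sum_(t in A) th t *: x t = 0 ->
  forall t, t \in A -> th t = 0.

Lemma spanm_mem A x t : t \in A -> (x t <= spanm A x)%MS.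
Proof. by move=> tA; rewrite /spanm (sumsmx_sup t)// genmxE. Qed.

Lemma spanm_subP A x m (W : 'M[R]_(m, n)) :
  reflect (forall t, t \in A -> (x t <= W)%MS) (spanm A x <= W)%MS.
Proof.
by apply: (iffP sumsmx_subP) => H t tA; move: (H t tA); rewrite genmxE.
Qed.

Lemma spanmS A B x : A \subset B -> (spanm A x <= spanm B x)%MS.
Proof. by move=> /subsetP AB; apply/spanm_subP => t /AB; apply: spanm_mem. Qed.

Lemma sum_spanm A x (th : T -> R) :
  ((\sum_(t in A) th t *: x t)%R <= spanm A x)%MS.
Proof. by apply: summx_sub => t tA; rewrite scalemx_sub// spanm_mem. Qed.

Lemma spanmP A x (v : 'rV[R]_n) :
  (v <= spanm A x)%MS -> exists th : T -> R, v = \sum_(t in A) th t *: x t.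
Proof.
move=> /sub_sumsmxP[u vE].
have /choice[th thE] : forall t, exists a, u t *m <<x t>>%MS = a *: x t.
  by move=> t; apply/sub_rVP; rewrite (submx_trans (submxMl _ _))// genmxE.
by exists th; rewrite vE; apply: eq_bigr.
Qed.

Lemma rank_spanmU1 A x t : t \notin A -> ~~ (x t <= spanm A x)%MS ->
  (\rank (spanm A x) < \rank (spanm (t |: A) x))%N.
Proof.
move=> tA xt; apply: rank_ltmx; rewrite ltmxE spanmS ?subsetUr//=.
by apply: contra xt; apply: submx_trans; rewrite spanm_mem ?setU11.
Qed.

Lemma indepU1 A x t : t \notin A -> indep A x -> ~~ (x t <= spanm A x)%MS ->
  indep (t |: A) x.
Proof.
move=> tA iA xt th; rewrite big_setU1//= => th0.
have tht : th t = 0.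
  apply: contraNeq xt => tht.

  have -> : x t = (th t)^-1 *: - \sum_(t in A) th t *: x t.
    move/eqP: th0; rewrite addr_eq0 => /eqP <-.
    by rewrite scalerA mulVf ?scale1r.
  by rewrite scalemx_sub// eqmx_opp sum_spanm.
move: th0; rewrite tht scale0r add0r => /iA th0 s.
by rewrite !inE => /orP[/eqP->|/th0].
Qed.

Lemma indepS A B x : A \subset B -> indep B x -> indep A x.
Proof.
move=> AB iB th th0 t tA.
have := iB (fun s => if s \in A then th s else 0) _ t (subsetP AB t tA).
rewrite tA; apply; rewrite -[RHS]th0 (big_setID A) /= (setIidPr AB).
rewrite [X in _ + X]big1 ?addr0 => [|s]; first by apply: eq_bigr => s ->.
by rewrite !inE => /andP[/negPf->]; rewrite scale0r.
Qed.

Lemma indep_rank A x : indep A x -> (#|A| <= \rank (spanm A x))%N.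
Proof.
have [m] := ubnP #|A|; elim: m => // m IH in A * => /ltnSE-leAm iA.
have [->|[t tA]] := set_0Vmem A; first by rewrite cards0.
have iA' : indep (A :\ t) x by apply: indepS iA; apply: subD1set.
have A'm : (#|A :\ t| < m)%N by move: leAm; rewrite (cardsD1 t) tA.
rewrite (cardsD1 t) tA add1n (leq_ltn_trans (IH _ A'm iA'))//.
rewrite -[in X in (_ < X)%N](setD1K tA) rank_spanmU1// ?setD11//.
apply/negP => /spanmP[th xt].
suff : (-1 : R) = 0 by move/eqP; rewrite oppr_eq0 oner_eq0.
have := iA (fun s => if s == t then -1 else th s) _ t tA.
rewrite eqxx; apply; rewrite (big_setD1 t)//= eqxx scaleN1r xt.
rewrite -sumrN -big_split /= big1// => s; rewrite !inE => /andP[/negPf-> _].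
by rewrite addNr.
Qed.

(** The ratio test of the simplex method: [c] is the least [mu s / th s] among the [s] with
    [0 < th s]. *)
Lemma positive_reduce A (mu th : T -> R) t :
  (forall s, s \in A -> 0 < mu s) -> t \in A -> 0 < th t ->
  exists c, [/\ 0 < c, forall s, s \in A -> 0 <= mu s - c * th s &
    exists2 s, s \in A & mu s - c * th s = 0].
Proof.
move=> mu_gt0 tA tht.
pose P s := (s \in A) && (0 < th s).
have Pt : P t by rewrite /P tA.
case: (arg_minP (fun s => mu s / th s) Pt) => t0 /andP[t0A tht0] min_t0.
exists (mu t0 / th t0); split; first by rewrite divr_gt0// mu_gt0.
  move=> s sA; have [ths|ths] := ltP 0 (th s).
    by rewrite subr_ge0 -ler_pdivlMr// min_t0// /P sA.
  rewrite subr_ge0 (@le_trans _ _ 0)//; last exact: ltW (mu_gt0 _ sA).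
  by rewrite mulr_ge0_le0// ltW// divr_gt0// mu_gt0.
by exists t0 => //; rewrite divfK ?subrr// gt_eqF.
Qed.

Lemma not_indep A x : ~ indep A x -> exists th : T -> R,
  \sum_(t in A) th t *: x t = 0 /\ exists2 t, t \in A & 0 < th t.
Proof.
move=> /existsNP[th /not_implyP[th0 /existsNP[t /not_implyP[tA /eqP tht]]]].
have [tht_gt0|tht_le0] := ltP 0 (th t); first by exists th; split=> //; exists t.
exists (\- th); split; last first.
  by exists t => //=; rewrite oppr_gt0 lt_neqAle tht.
by under eq_bigr do rewrite scaleNr; rewrite sumrN th0 oppr0.
Qed.

(** An inclusion-minimal support is independent, for [positive_reduce] along a linear dependence
    would shrink it. Supports are kept inside the positive part of [lam] for the sake of
    complementary slackness in [near_exists]. *)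
Lemma caratheodory A x (lam : T -> R) : (forall t, t \in A -> 0 <= lam t) ->
  exists B (mu : T -> R), [/\ B \subset A, indep B x,
    forall t, t \in B -> 0 < mu t, forall t, t \in B -> 0 < lam t &
    \sum_(t in B) mu t *: x t = \sum_(t in A) lam t *: x t].
Proof.
move=> lam_ge0.
pose P (B : {set T}) := `[< (B \subset [set t in A | 0 < lam t]) /\
  exists mu : T -> R, (forall t, t \in B -> 0 < mu t) /\
  \sum_(t in B) mu t *: x t = \sum_(t in A) lam t *: x t >].
have P0 : P [set t in A | 0 < lam t]%SET.
  apply/asboolP; split=> //; exists lam; split=> [t|]; first by rewrite inE => /andP[].
  rewrite [RHS](bigID (fun t => 0 < lam t)) /= [X in _ = _ + X]big1 ?addr0.
    by apply: eq_bigl => t; rewrite !inE.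
  move=> t /andP[tA]; rewrite -leNgt => lamt.
  by rewrite (_ : lam t = 0) ?scale0r//; apply/eqP; rewrite eq_le lamt lam_ge0.
have [B /minsetP[/asboolP[BA [mu [mu_gt0 muE]]] minB] _] := minset_exists P0.
exists B, mu; split=> //.
- by apply: subset_trans BA _; apply/subsetP => t; rewrite inE => /andP[].
- apply: contrapT => /not_indep[th [th0 [t tB tht]]].
  have [c [c_gt0 c_ge0 [s sB cs]]] := positive_reduce mu_gt0 tB tht.
  pose B' := [set t in B | 0 < mu t - c * th t]%SET.
  have B'B : B' \subset B by apply/subsetP => r; rewrite inE => /andP[].
  have /minB/(_ B'B) B'E : P B'.
    apply/asboolP; split; first exact: subset_trans BA.
    exists (fun r => mu r - c * th r); split=> [r|]; first by rewrite inE => /andP[].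
    rewrite -muE [RHS](_ : _ = \sum_(r in B) (mu r - c * th r) *: x r).
      rewrite [RHS](bigID (fun t => 0 < mu t - c * th t)) /= [X in _ = _ + X]big1 ?addr0.
        by apply: eq_bigl => r; rewrite !inE.
      move=> r /andP[rB]; rewrite -leNgt => r_le0.
      rewrite (_ : mu r - _ = 0) ?scale0r//.
      by apply/eqP; rewrite eq_le r_le0 c_ge0.
    under [RHS]eq_bigr do rewrite scalerBl -scalerA.
    by rewrite sumrB -scaler_sumr th0 scaler0 subr0.
  by move: sB; rewrite -B'E inE cs ltxx andbF.
- by move=> t /(subsetP BA); rewrite inE => /andP[].
Qed.

(** In an inclusion-minimal positive dependence, removing any one vector leaves an independent
    family, hence the size bound; nonzero vectors rule out singletons. *)
Lemma circuit A x (lam : T -> R) t0 : t0 \in A ->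
  (forall t, t \in A -> 0 < lam t) -> (forall t, t \in A -> x t != 0) ->
  \sum_(t in A) lam t *: x t = 0 ->
  exists B (mu : T -> R), [/\ B \subset A, (1 < #|B|)%N,
    forall t, t \in B -> 0 < mu t, \sum_(t in B) mu t *: x t = 0 &
    (#|B| <= (\rank (spanm B x)).+1)%N].
Proof.
move=> t0A lam_gt0 x_neq0 lam0.
pose P (B : {set T}) := `[< (B \subset A) /\ (B != set0)%SET /\
  exists mu : T -> R, (forall t, t \in B -> 0 < mu t) /\
  \sum_(t in B) mu t *: x t = 0 >].
have PA : P A.
  by apply/asboolP; split=> //; split; [apply/set0Pn; exists t0|exists lam].
have [B /minsetP[/asboolP[BA [B0 [mu [mu_gt0 muE]]]] minB] _] := minset_exists PA.
exists B, mu; have [b bB] := set0Pn _ B0; split=> //.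
  rewrite (cardsD1 b) bB ltnS lt0n cards_eq0.
  apply: contraNneq (x_neq0 b (subsetP BA b bB)) => Bb.
  move: muE; rewrite (big_setD1 b)//= Bb big_set0 addr0 => /eqP.
  by rewrite scaler_eq0 gt_eqF ?mu_gt0.
rewrite (cardsD1 b) bB add1n ltnS.
suff iB : indep (B :\ b) x.
  apply: leq_trans (indep_rank iB) _.
  by apply: mxrankS; apply: spanmS; apply: subD1set.
apply: contrapT => /not_indep[th [th0 [t tB tht]]].
pose th' s := if s == b then 0 else th s.
have tB' : t \in B by move: tB; rewrite inE => /andP[].
have tht' : 0 < th' t by move: tB; rewrite /th' !inE => /andP[/negPf-> _].
have [c [c_gt0 c_ge0 [s sB cs]]] := positive_reduce mu_gt0 tB' tht'.
pose B' := [set t in B | 0 < mu t - c * th' t]%SET.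
have B'B : B' \subset B by apply/subsetP => r; rewrite inE => /andP[].
have /minB/(_ B'B) B'E : P B'.
  apply/asboolP; split; first exact: subset_trans BA.
  split; first by apply/set0Pn; exists b; rewrite inE bB /th' eqxx mulr0 subr0 mu_gt0.
  exists (fun r => mu r - c * th' r); split=> [r|]; first by rewrite inE => /andP[].
  rewrite [RHS](_ : _ = \sum_(r in B) (mu r - c * th' r) *: x r).
    rewrite [RHS](bigID (fun t => 0 < mu t - c * th' t)) /= [X in _ = _ + X]big1 ?addr0.
      by apply: eq_bigl => r; rewrite !inE.
    move=> r /andP[rB]; rewrite -leNgt => r_le0.
    rewrite (_ : mu r - _ = 0) ?scale0r//.
    by apply/eqP; rewrite eq_le r_le0 c_ge0.
  under [RHS]eq_bigr do rewrite scalerBl -scalerA.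
  rewrite sumrB -scaler_sumr muE sub0r (big_setD1 b)//= /th' eqxx scale0r add0r.
  rewrite [X in _ *: X](_ : _ = 0) ?scaler0 ?oppr0// -[RHS]th0.
  by apply: eq_bigr => r; rewrite !inE => /andP[/negPf-> _].
by move: sB; rewrite -B'E inE cs ltxx andbF.
Qed.

Lemma max_indep A B x : B \subset A -> indep B x ->
  exists C : {set T}, [/\ B \subset C, C \subset A, indep C x &
                (spanm A x <= spanm C x)%MS].
Proof.
move=> BA iB; pose P (C : {set T}) := `[< (C \subset A) /\ indep C x >].
have PB : P B by apply/asboolP.
have [C /maxsetP[/asboolP[CA iC] maxC] BC] := maxset_exists PB.
exists C; split=> //; apply/spanm_subP => t tA; apply: contrapT => /negP xt.
have [tC|tC] := boolP (t \in C); first by rewrite spanm_mem in xt.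
have /maxC/(_ (subsetUr _ _)) tCE : P (t |: C).
  by apply/asboolP; split; [rewrite subUset sub1set tA|exact: indepU1].
by move: tC; rewrite -tCE setU11.
Qed.

(* A basis [C] together with the at most [rank] vectors that positively
   combine to minus the sum of [C]. *)
Lemma steinitz A B x (lam : T -> R) : (forall t, t \in A -> 0 < lam t) ->
  \sum_(t in A) lam t *: x t = 0 -> B \subset A -> indep B x ->
  exists (C : {set T}) (mu : T -> R), [/\ B \subset C, C \subset A,
    forall t, t \in C -> 0 < mu t, \sum_(t in C) mu t *: x t = 0 &
    (spanm C x == spanm A x)%MS /\ (#|C| <= 2 * \rank (spanm A x))%N].
Proof.
move=> lam_gt0 lam0 BA iB.
have [C [BC CA iC AC]] := max_indep BA iB.
(* With all coefficients scaled up to at least [1], one copy of each vector of [C] can be split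
   off. *)
have [M M_gt0 M_ge1] : exists2 M, 0 < M & forall t, t \in A -> 1 <= M * lam t.
  exists (1 + \sum_(t in A) (lam t)^-1).
    by rewrite ltr_pwDl// sumr_ge0// => t /lam_gt0 /ltW; rewrite invr_ge0.
  move=> t tA; rewrite -ler_pdivrMr ?lam_gt0// mul1r (big_setD1 t)//=.
  rewrite addrCA lerDl addr_ge0// sumr_ge0// => s; rewrite !inE => /andP[_].
  by move=> /lam_gt0 /ltW; rewrite invr_ge0.
pose nu t := M * lam t - (t \in C)%:R.
have nu_ge0 t : t \in A -> 0 <= nu t.
  move=> tA; rewrite subr_ge0 (le_trans _ (M_ge1 t tA))//.
  by case: (t \in C) => //=; rewrite ler01.
have [D [mu [DA iD mu_gt0 _ muE]]] := caratheodory x nu_ge0.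
have nuE : \sum_(t in A) nu t *: x t = - \sum_(t in C) x t.
  under eq_bigr do rewrite scalerBl -scalerA.
  rewrite sumrB -scaler_sumr lam0 scaler0 sub0r; congr (- _).
  rewrite (big_setID C) /= (setIidPr CA) [X in _ + X]big1 ?addr0.
    by apply: eq_bigr => t ->; rewrite scale1r.
  by move=> t; rewrite inE => /andP[/negPf->]; rewrite scale0r.
exists (C :|: D)%SET, (fun t => (t \in C)%:R + (if t \in D then mu t else 0)).
have CDA : C :|: D \subset A by rewrite subUset CA.
split=> //; first by rewrite (subset_trans BC)// subsetUl.
- move=> t; rewrite inE => /orP[tC|tD].
    by rewrite tC ltr_wpDr// ?ltr01//; case: ifPn => // /mu_gt0/ltW.
  by rewrite tD ltr_wpDl ?ler0n// mu_gt0.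
- under eq_bigr do rewrite scalerDl.
  rewrite big_split /= (big_setID C) /= (setIidPr (subsetUl _ _)).
  rewrite [X in _ + X + _]big1 ?addr0; last first.
    by move=> t; rewrite inE => /andP[/negPf->]; rewrite scale0r.
  rewrite [X in _ + X](big_setID D) /= (setIidPr (subsetUr _ _)).
  rewrite [X in _ + (_ + X)]big1 ?addr0; last first.
    by move=> t; rewrite inE => /andP[/negPf->]; rewrite scale0r.
  rewrite [X in _ + X](_ : _ = \sum_(t in D) mu t *: x t).
    rewrite muE nuE; apply/eqP; rewrite subr_eq0; apply/eqP.
    by apply: eq_bigr => t ->; rewrite scale1r.
  by apply: eq_bigr => t ->.
split; first by rewrite spanmS//= (submx_trans AC)// spanmS// subsetUl.
rewrite mul2n -addnn (leq_trans (leq_card_setU C D))// leq_add//.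
  by rewrite (leq_trans (indep_rank iC))// mxrankS// spanmS.
by rewrite (leq_trans (indep_rank iD))// mxrankS// spanmS.
Qed.

(* Since [A] positively spans [spanm A x], the coefficient of a vector of that
   span can be compensated inside [A]. *)
Lemma positive_absorb A x (lam : T -> R) (v : 'rV[R]_n) :
  (forall t, t \in A -> 0 < lam t) -> \sum_(t in A) lam t *: x t = 0 ->
  (v <= spanm A x)%MS ->
  exists2 mu : T -> R, forall t, t \in A -> 0 < mu t &
    v = \sum_(t in A) mu t *: x t.
Proof.
move=> lam_gt0 lam0 /spanmP[th vE].
exists (fun t => th t + (1 + \sum_(s in A) `|th s| / lam s) * lam t).
  move=> t tA; rewrite mulrDl mul1r (big_setD1 t)//= mulrDl divfK; last first.
    by rewrite gt_eqF// lam_gt0.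
  have : 0 <= (\sum_(s in A :\ t) `|th s| / lam s) * lam t.
    rewrite mulr_ge0 ?sumr_ge0// ?ltW ?lam_gt0// => s.
    by rewrite !inE => /andP[_ /lam_gt0/ltW sA]; rewrite divr_ge0.
  have := lam_gt0 t tA; have := ler_norm (- th t); rewrite normrN; lra.
under eq_bigr do rewrite scalerDl -scalerA.
by rewrite big_split /= -scaler_sumr lam0 scaler0 addr0.
Qed.

End PositiveDependence.

(** * Colourful Caratheodory *)

Section Lift.
Context (R : realFieldType) (n : nat).

Definition lift1 (x : 'rV[R]_n) (b : R) : 'rV[R]_(n + 1) := row_mx x b%:M.

Lemma dot_lift1 (z : 'rV[R]_(n + 1)) x b :
  dot z (lift1 x b) = dot (lsubmx z) x + rsubmx z 0 0 * b.
Proof.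
by rewrite -{1}[z]hsubmxK dot_row_mx [X in _ + X]dotE big_ord1 !mxE eqxx.
Qed.

Lemma lift1_sum (T : finType) (P : pred T) (th : T -> R) (x : T -> 'rV_n)
    (b : T -> R) :
  \sum_(t | P t) th t *: lift1 (x t) (b t) =
  lift1 (\sum_(t | P t) th t *: x t) (\sum_(t | P t) th t * b t).
Proof.
rewrite /lift1; under eq_bigr do rewrite scale_row_mx scale_scalar_mx.
elim/big_rec3: _ => [|t y1 y2 y3 _ ->].
  by rewrite raddf0 row_mx0.
by rewrite add_row_mx raddfD.
Qed.

Lemma lift1_inj x b y c : lift1 x b = lift1 y c -> x = y /\ b = c.
Proof.
move=> /eq_row_mx[-> /matrixP/(_ 0 0)]; by rewrite !mxE.
Qed.

Lemma lift1Z a x b : a *: lift1 x b = lift1 (a *: x) (a * b).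
Proof. by rewrite /lift1 scale_row_mx scale_scalar_mx. Qed.

Let e := lift1 0 1.

(* [z] is the vector from the nearest point of the cone over the lifted
   generators to the apex direction [lift1 0 1]. *)
Definition near (T : finType) (A : {set T}) (x : T -> 'rV_n) (b : T -> R)
    (z : 'rV_(n + 1)) :=
  (forall t, t \in A -> dot z (lift1 (x t) (b t)) <= 0) /\ dot z e = dot z z.

(** Unless [z = 0], independence holds already for the vectors without their lifted coordinate,
    which saves one in the bound on [#|B|]. *)
Definition near_supp (T : finType) (B : {set T}) (x : T -> 'rV_n) (b : T -> R)
    (mu : T -> R) (z : 'rV_(n + 1)) :=
  [/\ forall t, t \in B -> 0 < mu t,
      z = e - \sum_(t in B) mu t *: lift1 (x t) (b t) & z = 0 \/ indep B x].

(** A nonzero residual [z] is orthogonal to every generator in the support but not to the apex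
    direction. A dependence among the unlifted vectors lifts to a multiple of that direction, which
    is therefore zero. *)
Lemma near_exists (T : finType) (A : {set T}) (x : T -> 'rV_n) (b : T -> R) :
  exists z, near A x b z /\ exists (B : {set T}) (mu : T -> R), B \subset A /\
    near_supp B x b mu z.
Proof.
pose s t := lift1 (x t) (b t).
have [lam [lam_ge0 /=]] := cone_projection (@dotC R _) (@dotDl R _) (@dotZl R _)
  (@dot_ge0 R _) (@dot_eq0 R _) A s e.
set q := \sum_(t in A) _; set z := e - q => -[zs zq].
have ze : dot z e = dot z z by rewrite /z [in RHS]dotBr -/z zq subr0.
have lam_ge0A t : t \in A -> 0 <= lam t by move=> _.
have [B [mu [BA iB mu_gt0 lam_gt0 muE]]] := caratheodory s lam_ge0A.
have zs0 t : t \in A -> 0 < lam t -> dot z (s t) = 0.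
  move=> tA lamt; move/eqP: zq; rewrite dot_sumr -oppr_eq0 -sumrN psumr_eq0.
    move=> /allP/(_ t (mem_index_enum _)); rewrite tA /= oppr_eq0 dotZr.
    by rewrite mulf_eq0 gt_eqF//= => /eqP.
  by move=> i iA; rewrite oppr_ge0 dotZr mulr_ge0_le0// zs.
exists z; split; first by split.
exists B, mu; split=> //; split=> //; first by rewrite muE.
have [->|z0] := eqVneq z 0; [by left|right] => th th0.
have thE : \sum_(t in B) th t *: s t = (\sum_(t in B) th t * b t) *: e.
  by rewrite lift1_sum th0 lift1Z scaler0 mulr1.
have : dot z (\sum_(t in B) th t *: s t) = 0.
  rewrite dot_sumr big1// => t tB.
  by rewrite dotZr zs0 ?mulr0 ?lam_gt0// (subsetP BA).
rewrite thE dotZr ze => /eqP; rewrite mulf_eq0 => /orP[/eqP k0|/eqP/dot_eq0 z1].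
  by apply: iB; rewrite thE k0 scale0r.
by rewrite z1 eqxx in z0.
Qed.

Lemma near_optimal (T : finType) (A B : {set T}) (x : T -> 'rV_n) (b : T -> R)
    (z z' : 'rV_(n + 1)) (mu : T -> R) :
  near A x b z -> B \subset A -> (forall t, t \in B -> 0 <= mu t) ->
  z' = e - \sum_(t in B) mu t *: lift1 (x t) (b t) -> dot z z <= dot z' z'.
Proof.
move=> [zs ze] BA mu_ge0 ->.
apply: (cone_optimal (@dotC R _) (@dotDl R _) (@dotZl R _)
  (@dot_ge0 R _)) => // t tB.
exact/zs/(subsetP BA).
Qed.

(** As the generators of [B] survive the replacement, the old nearest point is still available, and
    the new generator of [j] leads closer to the apex direction. *)
Lemma near_exchange (T : finType) (A B : {set T}) (x x' : T -> 'rV_n)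
    (b b' : T -> R) (z z' : 'rV_(n + 1)) (mu : T -> R) (j : T) :
  near_supp B x b mu z -> near A x' b' z' -> B \subset A -> j \in A ->
  j \notin B -> (forall t, t \in B -> x' t = x t /\ b' t = b t) ->
  0 < dot z (lift1 (x' j) (b' j)) -> dot z' z' < dot z z.
Proof.
move=> [mu_gt0 zE _] nz' BA jA jB xx' zj.
have [ep ep_gt0 lt_ep] := cone_improve (@dotC R _) (@dotDl R _) (@dotZl R _)
  (@dot_ge0 R _) (@dot_eq0 R _) zj.
apply: le_lt_trans lt_ep.
apply: (near_optimal (B := j |: B) (mu := fun t => if t == j then ep else mu t) nz').
- by rewrite subUset sub1set jA.
- by move=> t; rewrite !inE; case: eqP => [_ _|_ /= /mu_gt0/ltW//]; apply: ltW.
- rewrite big_setU1//= eqxx zE -addrA -opprD; congr (e - _).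
  rewrite addrC; congr (_ + _); apply: eq_bigr => t tB.
  by have [-> ->] := xx' t tB; case: eqP jB => // <-; rewrite tB.
Qed.

End Lift.

(** Barany's argument: take the rainbow whose cone is nearest to the apex direction. If it does not
    reach it, its support misses some colour [j] because [\rank W < #|A|], and a vector of colour
    [j] on the good side of [z] can be exchanged in. *)
Lemma colourful_caratheodory (R : realFieldType) (I K : finType) (n : nat)
    (A : {set I}) (x : I -> K -> 'rV[R]_n) (m : nat) (W : 'M[R]_(m, n)) :
  (forall i, i \in A -> exists lam : K -> R, [/\ forall k, 0 <= lam k,
     \sum_k lam k *: x i k = 0 & exists2 k, 0 < lam k & x i k != 0]) ->
  (forall i k, (x i k <= W)%MS) -> (\rank W < #|A|)%N ->
  exists (s : {ffun I -> K}) (lam : I -> R), [/\ forall i, 0 <= lam i,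
    \sum_(i in A) lam i *: x i (s i) = 0 &
    exists2 i, i \in A & 0 < lam i /\ x i (s i) != 0].
Proof.
move=> Hx xW WA.
have [i0 i0A] : exists i, i \in A by apply/card_gt0P; case: #|A| WA.
have [_ [_ _ [k0 _ _]]] := Hx i0 i0A.
(* Only nonzero vectors get a lifted coordinate, so that reaching the apex direction yields a
   nontrivial dependence. *)
pose b i k := (x i k != 0)%:R : R.
have /choice[z /all_and2[znear zsupp]] (s : {ffun I -> K}) :=
  near_exists A (fun i => x i (s i)) (fun i => b i (s i)).
have [s _ smin] :
    extremum_spec (<=%O) predT (fun s => dot (z s) (z s))
      [arg min_(s < [ffun=> k0]) dot (z s) (z s)]%O by exact: arg_minP.
have [B [mu [BA [mu_gt0 zE zB]]]] := zsupp s.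
exists s.
have [z0|z0] := eqVneq (z s) 0.
  move: zE; rewrite z0 => /esym/subr0_eq; rewrite lift1_sum => /lift1_inj[x0 b1].
  exists (fun i => if i \in B then mu i else 0); split=> [i||].
  - by case: ifP => // /mu_gt0/ltW.
  - rewrite (big_setID B) /= (setIidPr BA) [X in _ + X]big1 ?addr0.
      by rewrite [RHS]x0; apply: eq_bigr => i ->.
    by move=> i; rewrite inE => /andP[/negPf->]; rewrite scale0r.
  - apply: contrapT => nex; move: b1; rewrite big1; last first.
      move=> i iB; rewrite /b; case: eqP => [_|/eqP xi]; first by rewrite mulr0.
      by case: nex; exists i; [exact: (subsetP BA)|rewrite iB mu_gt0].
    by move/eqP; rewrite oner_eq0.
case: zB => [zs0|iB]; first by rewrite zs0 eqxx in z0.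
have zz_gt0 : 0 < dot (z s) (z s).
  by rewrite lt_def dot_ge0 andbT; apply: contraNneq z0 => /dot_eq0->.
have /subsetPn[j jA jB] : ~~ (A \subset B).
  apply: contraL WA => /subset_leq_card AB; rewrite -leqNgt (leq_trans AB)//.
  rewrite (leq_trans (indep_rank iB))// mxrankS//.
  by apply/spanm_subP => i _; apply: xW.
have [lam [lam_ge0 lam0 [k1 lamk1 xk1]]] := Hx j jA.
have [k zk] : exists k, 0 < dot (z s) (lift1 (x j k) (b j k)).
  apply: contrapT => nex.
  have : dot (z s) (\sum_k lam k *: lift1 (x j k) (b j k)) <= 0.
    rewrite dot_sumr; apply: sumr_le0 => k _; rewrite dotZr mulr_ge0_le0//.
    by rewrite leNgt; apply/negP => zk; apply: nex; exists k.
  rewrite lift1_sum lam0; set S := \sum_k _.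
  have -> : lift1 0 S = S *: lift1 (0 : 'rV[R]_n) 1 by rewrite lift1Z scaler0 mulr1.
  rewrite dotZr (znear s).2 pmulr_lle0// leNgt => /negP; apply.
  rewrite /S (bigD1 k1)//= ltr_pwDl//.
    by rewrite /b xk1 mulr1.
  by apply: sumr_ge0 => k _; rewrite mulr_ge0// ler0n.
pose s' : {ffun I -> K} := [ffun i => if i == j then k else s i].
have : dot (z s') (z s') < dot (z s) (z s).
  have s'j : s' j = k by rewrite ffunE eqxx.
  apply: (near_exchange (j := j) (And3 mu_gt0 zE (or_intror iB)) (znear s') BA jA jB).
    move=> i iB'; rewrite ffunE; case: eqP => // ij.
    by rewrite -ij iB' in jB.
  by rewrite s'j.
by rewrite ltNge smin.
Qed.

(** * Combining certificates of the colours *)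

Section Dual.
Context (R : realFieldType) (I K : finType) (d : nat).
Implicit Types (s : {ffun I -> K}) (J B : {set I}).
Variables (A : {set I}) (u : I -> K -> 'rV[R]_d) (c : I -> K -> R) (r : nat).

#[local] Definition us s i := u i (s i).
#[local] Definition cs s i := - c i (s i).

(** The positive dependence makes the normals span their linear span positively; the size bound is
    the one that [steinitz] restores after an exchange. *)
#[local] Definition tight s J := [/\ J \subset A,
  exists2 lam : I -> R, forall i, i \in J -> 0 < lam i &
    \sum_(i in J) lam i *: us s i = 0 &
  (#|J| <= 2 * \rank (spanm J (us s)))%N].

Hypothesis no_infeasible : forall s J (lam : I -> R), J \subset A ->
  (forall i, i \in J -> 0 <= lam i) -> \sum_(i in J) lam i *: us s i = 0 ->
  0 <= \sum_(i in J) lam i * c i (s i).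

#[local] Lemma near_neq0 s J z mu :
  J \subset A -> near_supp J (us s) (cs s) mu z -> z != 0.
Proof.
move=> JA [mu_gt0 zE _]; apply/eqP => z0; move: zE; rewrite z0.
move=> /esym/subr0_eq; rewrite lift1_sum => /lift1_inj[/esym u0 /esym c1].
have mu_ge0 i : i \in J -> 0 <= mu i by move=> /mu_gt0/ltW.
have := no_infeasible JA mu_ge0 u0; move: c1; rewrite /cs.
under eq_bigr do rewrite mulrN.
by rewrite sumrN => /eqP; rewrite eqr_oppLR => /eqP->; rewrite ler0N1.
Qed.

(* If the colour [i] is infeasible inside the span of [J], exchanging it in
   brings the cone over [J] closer to the apex direction. *)
#[local] Lemma exchange s J z mu B (i : I) (lam : K -> R) : tight s J -> B \subset J ->
  near_supp B (us s) (cs s) mu z -> near J (us s) (cs s) z ->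
  i \in A -> i \notin J -> (forall k, 0 <= lam k) ->
  \sum_k lam k *: u i k = 0 -> \sum_k lam k * c i k < 0 ->
  (forall k, 0 < lam k -> (u i k <= spanm J (us s))%MS) ->
  exists s' (J' : {set I}), [/\ tight s' J',
    \rank (spanm J' (us s')) = \rank (spanm J (us s)) &
    forall z', near J' (us s') (cs s') z' -> dot z' z' < dot z z].
Proof.
move=> [JA [nu nu_gt0 nu0] J2] BJ zsupp znear iA iJ lam_ge0 lam0 lamc lamJ.
have z0 := near_neq0 (subset_trans BJ JA) zsupp.
have zz_gt0 : 0 < dot z z.
  by rewrite lt_def dot_ge0 andbT; apply: contraNneq z0 => /dot_eq0->.
(* Weighting the generators of colour [i] by [lam] yields a positive multiple of the apex direction,
   on which [z] is positive; so [z] is positive on one of them. *)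
have [k lamk zk] : exists2 k, 0 < lam k & 0 < dot z (lift1 (u i k) (- c i k)).
  apply: contrapT => nex.
  have : dot z (\sum_k lam k *: lift1 (u i k) (- c i k)) <= 0.
    rewrite dot_sumr; apply: sumr_le0 => k _; rewrite dotZr.
    have := lam_ge0 k; rewrite le_eqVlt => /orP[/eqP<-|lamk]; first by rewrite mul0r.
    by rewrite pmulr_rle0// leNgt; apply/negP => zk; apply: nex; exists k.
  rewrite lift1_sum lam0; set S := \sum_k _.
  have -> : lift1 0 S = S *: lift1 (0 : 'rV[R]_d) 1 by rewrite lift1Z scaler0 mulr1.
  rewrite dotZr znear.2 pmulr_lle0// leNgt => /negP; apply.
  by rewrite /S; under eq_bigr do rewrite mulrN; rewrite sumrN oppr_gt0.
pose s' : {ffun I -> K} := [ffun j => if j == i then k else s j].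
have s'i : s' i = k by rewrite ffunE eqxx.
have s'J j : j \in J -> s' j = s j.
  by move=> jJ; rewrite ffunE; case: eqP jJ => // ->; rewrite (negPf iJ).
pose T := i |: J.
have JT : J \subset T by apply: subsetUr.
have TA : T \subset A by rewrite subUset sub1set iA.
have spanJ : (spanm J (us s') :=: spanm J (us s))%MS.
  apply/eqmxP/andP; split; apply/spanm_subP => j jJ.
    by rewrite /us s'J// spanm_mem.
  by rewrite /us -(s'J j jJ); apply: (spanm_mem (us s')).
have spanT : (spanm T (us s') :=: spanm J (us s))%MS.
  apply/eqmxP/andP; split; last by rewrite -spanJ spanmS.
  apply/spanm_subP => j; rewrite in_setU1 => /orP[/eqP->|jJ].
    by rewrite /us s'i lamJ.
  by rewrite -spanJ spanm_mem.
have [lamT lamT_gt0 lamT0] : exists2 th : I -> R, forall j, j \in T -> 0 < th j &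
    \sum_(j in T) th j *: us s' j = 0.
  have [|th th_gt0 uE] := @positive_absorb _ _ _ J (us s) nu (- u i k) nu_gt0 nu0.
    by rewrite eqmx_opp lamJ.
  exists (fun j => if j == i then 1 else th j) => [j|].
    by rewrite in_setU1; case: eqP => //= _; apply: th_gt0.
  rewrite big_setU1//= eqxx scale1r /us s'i -[u i k]opprK uE addrC.
  apply/eqP; rewrite subr_eq0; apply/eqP; apply: eq_bigr => j jJ.
  by rewrite s'J//; case: eqP jJ => // ->; rewrite (negPf iJ).
have [z' [z'near [B0 [mu' [B0T z'supp]]]]] := near_exists T (us s') (cs s').
have z'0 := near_neq0 (subset_trans B0T TA) z'supp.
have iB0 : indep B0 (us s').
  by case: z'supp => _ _ [z'00|//]; rewrite z'00 eqxx in z'0.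
have [J' [muJ' [B0J' J'T muJ'_gt0 muJ'0 [/eqmxP spanJ' J'2]]]] :=
  steinitz lamT_gt0 lamT0 B0T iB0.
exists s', J'; split.
- split; [exact: subset_trans TA|by exists muJ'|by rewrite spanJ'].
- by rewrite spanJ' spanT.
- move=> z'' z''near; case: z'supp => mu'_gt0 z'E _.
  have mu'_ge0 t : t \in B0 -> 0 <= mu' t by move/mu'_gt0/ltW.
  apply: le_lt_trans (near_optimal z''near B0J' mu'_ge0 z'E) _.
  apply: (near_exchange (j := i) zsupp z'near).
  + exact: subset_trans JT.
  + exact: setU11.
  + by apply: contra iJ; apply: (subsetP BJ).
  + by move=> t /(subsetP BJ) tJ; rewrite /us /cs s'J.
  + by rewrite /us /cs s'i.
Qed.

(* Apply colourful Caratheodory modulo the span of [J]. *)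
#[local] Lemma extend s J : tight s J ->
  (forall i, i \in A -> i \notin J -> exists lam : K -> R,
     [/\ forall k, 0 <= lam k, \sum_k lam k *: u i k = 0 &
      exists2 k, 0 < lam k & ~~ (u i k <= spanm J (us s))%MS]) ->
  (d + \rank (spanm J (us s)) < #|A|)%N ->
  exists s' J', tight s' J' /\
    (\rank (spanm J (us s)) < \rank (spanm J' (us s')))%N.
Proof.
move=> [JA [nu nu_gt0 nu0] J2]; set W := spanm J (us s) => Hout ltA.
pose x i k := u i k *m cokermx W.
have Hx i : i \in A :\: J -> exists lam : K -> R, [/\ forall k, 0 <= lam k,
     \sum_k lam k *: x i k = 0 & exists2 k, 0 < lam k & x i k != 0].
  rewrite inE => /andP[iJ iA]; have [lam [lam_ge0 lam0 [k lamk uk]]] := Hout i iA iJ.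
  exists lam; split=> //; last by exists k => //; rewrite /x -submxE.
  by under eq_bigr do rewrite /x scalemxAl; rewrite -mulmx_suml lam0 mul0mx.
have xW i k : (x i k <= cokermx W)%MS by apply: submxMl.
have AJ : (\rank (cokermx W) < #|A :\: J|)%N.
  rewrite mxrank_coker cardsD (setIidPr JA) -/W.
  by have := rank_leq_col W; move: J2 ltA; rewrite -/W; lia.
have [s1 [lam [lam_ge0 lam0 [i0 i0A [lami0 xi0]]]]] :=
  colourful_caratheodory Hx xW AJ.
pose X0 := [set i in A :\: J | (0 < lam i) && (x i (s1 i) != 0)].
have [||||X [mu [XX0 X2 mu_gt0 mu0 Xrk]]] :=
    @circuit R I d X0 (fun i => x i (s1 i)) lam i0.
- by rewrite inE i0A lami0.
- by move=> i; rewrite inE => /and3P[].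
- by move=> i; rewrite inE => /and3P[].
- rewrite -[RHS]lam0 [RHS](big_setID X0) /= (setIidPr _); last first.
    by apply/subsetP => i; rewrite inE => /andP[].
  rewrite [X in _ = _ + X]big1 ?addr0// => i; rewrite !inE => /andP[+ iA].
  rewrite iA /= negb_and negbK => /orP[|/eqP->]; last exact: scaler0.
  rewrite -leNgt => lami; rewrite (_ : lam i = 0) ?scale0r//.
  by apply/eqP; rewrite eq_le lami lam_ge0.
have XA : X \subset A :\: J.
  by apply: subset_trans XX0 _; apply/subsetP => i; rewrite inE => /andP[].
have XJ i : i \in X -> i \notin J.
  by move=> /(subsetP XA); rewrite inE => /andP[].
have dXJ : [disjoint J & X].
  by rewrite disjoint_sym disjoint_subset; apply/subsetP => i /XJ.
pose s' : {ffun I -> K} := [ffun i => if i \in J then s i else s1 i].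
have s'J i : i \in J -> us s' i = us s i by move=> iJ; rewrite /us ffunE iJ.
have s'X i : i \in X -> us s' i = us s1 i.
  by move=> /XJ iJ; rewrite /us ffunE (negPf iJ).
(* Modulo [W] the circuit [X] has rank at least [#|X| - 1]. Since [#|X| >= 2], the rank grows and
   the bound by twice the rank persists. *)
have rk : (\rank W + #|X| <= (\rank (spanm (J :|: X) (us s'))).+1)%N.
  set S := spanm _ _.
  rewrite -(mxrank_mul_ker S (cokermx W)) addnC -addSn leq_add//.
    apply: leq_trans Xrk _; rewrite ltnS mxrankS//.
    apply/spanm_subP => i iX; apply: submxMr.
    by rewrite -/(us s1 i) -s'X// spanm_mem// inE iX orbT.
  rewrite mxrankS// sub_capmx; apply/andP; split.
    by apply/spanm_subP => i iJ; rewrite -s'J// spanm_mem// inE iJ.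
  by apply/sub_kermxP; rewrite mulmx_coker.
exists s', (J :|: X); split; last by move: rk X2; lia.
split.
- by rewrite subUset JA (subset_trans XA)// subsetDl.
- have [|th th_gt0 thE] := @positive_absorb _ _ _ J (us s) nu
      (- \sum_(i in X) mu i *: us s1 i) nu_gt0 nu0.
    rewrite eqmx_opp submxE mulmx_suml; apply/eqP; rewrite -[RHS]mu0.
    by apply: eq_bigr => i _; rewrite scalemxAl.
  exists (fun i => if i \in J then th i else mu i) => [i|].
    by rewrite inE; case: ifP => [/th_gt0//|_ /= /mu_gt0].
  rewrite (big_setID J) /= (setIidPr (subsetUl _ _)) setDUl setDv set0U.
  have -> : X :\: J = X by apply/setDidPl; rewrite disjoint_sym.
  rewrite [X in X + _](_ : _ = \sum_(i in J) th i *: us s i); last first.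
    by apply: eq_bigr => i iJ; rewrite iJ s'J.
  rewrite -thE addrC; apply/eqP; rewrite subr_eq0; apply/eqP.
  by apply: eq_bigr => i iX; rewrite (negPf (XJ i iX)) s'X.
- rewrite (leq_trans (leq_card_setU J X))//.
  by move: rk X2 J2; rewrite -/W; lia.
Qed.

(** The rank is maximized first, then the distance minimized. Below rank [r], a colour outside [J]
    whose certificate stays in the span is infeasible there, and [exchange] contradicts minimality;
    so all those colours leave the span, and [extend] contradicts maximality. *)
Lemma rainbow_lineality (k0 : K) : (d + r <= #|A|)%N ->
  (forall i, i \in A -> exists lam : K -> R,
     [/\ forall k, 0 <= lam k, \sum_k lam k *: u i k = 0 &
      \sum_k lam k * c i k < 0 \/
      (r <= \rank (spanm [set k | (0 < lam k)%R] (u i)))%N]) ->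
  exists s J (lam : I -> R), [/\ J \subset A, forall i, i \in J -> 0 < lam i,
    \sum_(i in J) lam i *: u i (s i) = 0 &
    (r <= \rank (spanm J (fun i => u i (s i))))%N].
Proof.
move=> rA Hfam.
pose st (p : {ffun I -> K} * {set I}) := `[< tight p.1 p.2 >].
pose rk (p : {ffun I -> K} * {set I}) := \rank (spanm p.2 (us p.1)).
have st0 : st ([ffun=> k0], finset.set0).
  apply/asboolP; split=> /=; rewrite ?sub0set ?cards0//.
  by exists (fun=> 0) => [i|]; rewrite ?inE// big_set0.
case: (arg_maxnP rk st0) => p1 st1 max1.
have [r1|r1] := leqP r (rk p1).
  move/asboolP: st1 => [JA [lam lam_gt0 lam0] _].
  by exists p1.1, p1.2, lam.
have /choice[z /all_and2[znear zsupp]] (p : {ffun I -> K} * {set I}) :=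
  near_exists p.2 (us p.1) (cs p.1).
pose st' p := st p && (rk p == rk p1).
have st1' : st' p1 by rewrite /st' st1 eqxx.
have := @arg_minP _ _ _ p1 st' (fun p => dot (z p) (z p)) st1'.
case=> -[s J] /andP[/asboolP/= tsJ /eqP rkE] minz; exfalso.
have [||s' [J' [ts'J' lt_rk]]] := @extend s J tsJ.
- move=> i iA iJ; have [lam [lam_ge0 lam0 Hlam]] := Hfam i iA.
  exists lam; split=> //; apply: contrapT => nex.
  have lamJ k : 0 < lam k -> (u i k <= spanm J (us s))%MS.
    by move=> lamk; apply/negPn/negP => uk; apply: nex; exists k.
  case: Hlam => [lamc|]; last first.
    apply/negP; rewrite -ltnNge; apply: leq_ltn_trans r1; rewrite -rkE.
    by apply: mxrankS; apply/spanm_subP => k; rewrite inE => /lamJ.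
  have [B [mu [BJ zB]]] := zsupp (s, J).
  have [s' [J' [ts'J' rk' ltz]]] :=
    exchange tsJ BJ zB (znear (s, J)) iA iJ lam_ge0 lam0 lamc lamJ.
  have := ltz _ (znear (s', J')); rewrite ltNge minz//.
  by rewrite /st' -rkE /rk /= rk' eqxx andbT; apply/asboolP.
- by move: r1 rA; rewrite -rkE /rk /=; lia.
- have /max1 : st (s', J') by apply/asboolP.
  by move: rkE lt_rk; rewrite /rk /= => ->; rewrite ltnNge => /negP.
Qed.

End Dual.

(** * Convex sets containing cones *)

Section Cones.
Context (R : realFieldType) (d : nat).
Implicit Types (S : 'rV[R]_d -> Prop) (p v w : 'rV[R]_d).

Definition cvx S := forall x y t, S x -> S y -> 0 <= t <= 1 ->
  S (t *: x + (1 - t) *: y).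

Definition ray p S v := forall t, 0 <= t -> S (p + t *: v).

(* Only the apex and the extreme rays are required to lie in [S]; for convex [S]
   the whole cone then does.  Rows of [C] may be dependent or zero. *)
Definition hascone k S := exists p (C : 'M[R]_d),
  [/\ S p, (k <= \rank C)%N & forall l, ray p S (row l C)].

Lemma cvx_sum S (T : finType) (A : {set T}) (mu : T -> R) (a : T -> 'rV[R]_d) :
  cvx S -> (forall t, t \in A -> 0 <= mu t) -> \sum_(t in A) mu t = 1 ->
  (forall t, t \in A -> S (a t)) -> S (\sum_(t in A) mu t *: a t).
Proof.
move=> cS; have [m] := ubnP #|A|; elim: m => // m IH in A mu *.
move=> /ltnSE-leAm mu_ge0 mu1 Sa.
have [A0|[t tA]] := set_0Vmem A.
  by move/eqP: mu1; rewrite A0 big_set0 eq_sym oner_eq0.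
have A'm : (#|A :\ t| < m)%N by move: leAm; rewrite (cardsD1 t) tA.
rewrite (big_setD1 t)//=; set q := \sum_(i in _) _.
move: mu1; rewrite (big_setD1 t)//=; set sg := \sum_(i in _) _ => mu1.
have mu'_ge0 s : s \in A :\ t -> 0 <= mu s.
  by rewrite !inE => /andP[_]; apply: mu_ge0.
have sg_ge0 : 0 <= sg by apply: sumr_ge0.
have [sg0|sg0] := eqVneq sg 0.
  suff -> : q = 0.
    by move: mu1; rewrite sg0 !addr0 => ->; rewrite scale1r; apply: Sa.
  apply: big1 => s sA; move/eqP: sg0; rewrite psumr_eq0// => /allP.
  by move=> /(_ s (mem_index_enum _)); rewrite sA => /eqP->; rewrite scale0r.
have -> : q = (1 - mu t) *: (\sum_(s in A :\ t) (mu s / sg) *: a s).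
  rewrite -mu1 addrAC subrr add0r scaler_sumr; apply: eq_bigr => s _.
  by rewrite scalerA mulrCA divff// mulr1.
apply: cS; [exact: Sa| |by rewrite mu_ge0//= -mu1 lerDl].
apply: IH => // [s /mu'_ge0 s_ge0||s]; first exact: divr_ge0.
  by rewrite -mulr_suml divff.
by rewrite !inE => /andP[_]; apply: Sa.
Qed.

Lemma rayZ p S v a : 0 <= a -> ray p S v -> ray p S (a *: v).
Proof. by move=> a_ge0 pv t t_ge0; rewrite scalerA; apply/pv/mulr_ge0. Qed.

Lemma rayD p S v w : cvx S -> ray p S v -> ray p S w -> ray p S (v + w).
Proof.
move=> cS pv pw t t_ge0.
have -> : p + t *: (v + w) =
    2^-1 *: (p + (2 * t) *: v) + (1 - 2^-1) *: (p + (2 * t) *: w).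
  have -> : 1 - 2^-1 = 2^-1 :> R by field.
  rewrite -scalerDr addrACA -scalerDr [RHS]scalerDr [2^-1 *: (_ *: _)]scalerA.
  have -> : 2^-1 * (2 * t) = t by field.
  by rewrite -mulr2n -scaler_nat scalerA mulVf ?scale1r// pnatr_eq0.
by apply: cS; [apply: pv; lra|apply: pw; lra|lra].
Qed.

Lemma ray_sum p S (T : finType) (P : pred T) (co : T -> R) (v : T -> 'rV[R]_d) :
  cvx S -> S p -> (forall t, P t -> 0 <= co t) ->
  (forall t, P t -> ray p S (v t)) -> ray p S (\sum_(t | P t) co t *: v t).
Proof.
move=> cS Sp co_ge0 pv; apply: big_ind => [t _|x y|t Pt].
- by rewrite scaler0 addr0.
- exact: rayD.
- by apply: rayZ; [exact: co_ge0|exact: pv].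
Qed.

Lemma ray_shift p S v w : cvx S -> ray p S w -> ray p S v -> ray (p + w) S v.
Proof.
move=> cS pw pv t t_ge0; rewrite -addrA -[w + _]scale1r.
by apply: (rayD cS pw (rayZ t_ge0 pv)); apply: ler01.
Qed.

(** The whole displacement is loaded on [a t0], divided by its weight. *)
Lemma ray_mix S (T : finType) (A : {set T}) (mu : T -> R) (a : T -> 'rV[R]_d)
    t0 v :
  cvx S -> (forall t, t \in A -> 0 <= mu t) -> \sum_(t in A) mu t = 1 ->
  (forall t, t \in A -> S (a t)) -> t0 \in A -> 0 < mu t0 ->
  ray (a t0) S v -> ray (\sum_(t in A) mu t *: a t) S v.
Proof.
move=> cS mu_ge0 mu1 Sa t0A mut0 av s s_ge0.
have -> : \sum_(t in A) mu t *: a t + s *: v =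
    \sum_(t in A) mu t *: (if t == t0 then a t + (s / mu t) *: v else a t).
  rewrite (big_setD1 t0)// [RHS](big_setD1 t0)//= eqxx scalerDr scalerA.
  rewrite mulrCA divff ?gt_eqF// mulr1 addrAC; congr (_ + _).
  by apply: eq_bigr => t; rewrite !inE => /andP[/negPf->].
apply: cvx_sum => // t tA; case: eqP => [->|_]; last exact: Sa.
by apply: av; rewrite divr_ge0// ltW.
Qed.

(** A maximal free set of rows, padded by zero rows, fits the square format of [hascone]. *)
Lemma hasconeW k S p m (M : 'M[R]_(m, d)) : S p -> (k <= \rank M)%N ->
  (forall l, ray p S (row l M)) -> hascone k S.
Proof.
move=> Sp kM Mp; pose f := maxrankfun M.
pose C : 'M[R]_d := \matrix_l
  (if insub (l : nat) : option 'I_(\rank M) is Some j then row (f j) M else 0).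
exists p, C; split=> //; last first.
  move=> l; rewrite rowK; case: insubP => [j _ _|_]; first exact: Mp.
  by move=> t _; rewrite scaler0 addr0.
apply: (leq_trans kM); apply: (@leq_trans (\rank (rowsub f M))).
  by rewrite (eqnP (maxrowsub_free M)).
apply: mxrankS; apply/row_subP => j.
have jd : (j < d)%N := leq_trans (ltn_ord j) (rank_leq_col M).
have -> : row j (rowsub f M) = row (Ordinal jd) C.
  rewrite rowK; case: insubP => [j' _ /= j'E|]; last by rewrite /= ltn_ord.
  by rewrite row_rowsub; congr (row (f _) M); apply: val_inj.
exact: row_sub.
Qed.

Lemma hascone_le k k' S : (k' <= k)%N -> hascone k S -> hascone k' S.
Proof.
by move=> le_k [p [C [Sp kC pC]]]; exists p, C; split=> //; apply: leq_trans kC.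
Qed.

Lemma hasconeS k S S' : (forall x, S x -> S' x) -> hascone k S -> hascone k S'.
Proof.
move=> SS' [p [C [Sp kC pC]]]; exists p, C; split=> //; first exact: SS'.
by move=> l t t_ge0; apply/SS'/pC.
Qed.

End Cones.

(** * Homogenized cones and common relative interior points *)

Section GeneratorSum.
Context (R : realFieldType) (d : nat) (T : finType).
Context (a : T -> 'rV[R]_d) (C : T -> 'M[R]_d).

(* Homogenized generators of the cones [a t + Pos (rows of C t)]. *)
Definition gen (f : T + T * 'I_d) : 'rV[R]_(d + 1) := match f with
  | inl t => lift1 (a t) 1 | inr (t, l) => lift1 (row l (C t)) 0 end.

Definition gen_ix (f : T + T * 'I_d) : T :=
  match f with inl t => t | inr (t, _) => t end.

Lemma gen_sum (P : pred T) (co : T + T * 'I_d -> R) :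
  \sum_(f | P (gen_ix f)) co f *: gen f = lift1
    (\sum_(t | P t) (co (inl t) *: a t +
                     \sum_l co (inr (t, l)) *: row l (C t)))
    (\sum_(t | P t) co (inl t)).
Proof.
rewrite big_sumType /= lift1_sum.
rewrite (eq_bigr (fun e => co (inr (e.1, e.2)) *: lift1 (row e.2 (C e.1)) 0));
  last by case.
rewrite (eq_bigl (fun e : T * 'I_d => P e.1 && true)); last first.
  by case=> t l; rewrite andbT.
rewrite -(pair_big_dep P (fun _ _ => true)
  (fun t l => co (inr (t, l)) *: lift1 (row l (C t)) 0)) /=.
have -> : \sum_(t | P t) \sum_l co (inr (t, l)) *: lift1 (row l (C t)) 0
   = lift1 (\sum_(t | P t) \sum_l co (inr (t, l)) *: row l (C t)) 0.
  transitivity (\sum_(t | P t) (1 : R) *: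
      lift1 (\sum_l co (inr (t, l)) *: row l (C t)) 0).
    apply: eq_bigr => t _; rewrite scale1r lift1_sum; congr lift1.
    by apply: big1 => l _; rewrite mulr0.
  rewrite lift1_sum; congr lift1; first by under eq_bigr do rewrite scale1r.
  by apply: big1 => t _; rewrite mulr0.
rewrite /lift1 add_row_mx -raddfD /= addr0; congr (row_mx _ _).
  by rewrite big_split.
by congr (_%:M); apply: eq_bigr => t _; rewrite mulr1.
Qed.

End GeneratorSum.

Section CommonPoint.
Context (R : realFieldType) (d : nat) (T J : finType) (A : {set J}).
Context (inc : J -> T -> bool) (a : T -> 'rV[R]_d) (C : T -> 'M[R]_d).

(* A common point of the relative interiors of the hulls of the cones
   [a t + Pos (rows of C t)], [t] incident to [i], for [i] in [A]. *)
Definition common_point (x : 'rV[R]_d) := forall i, i \in A ->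
  exists (lam : T -> R) (co : T -> 'I_d -> R),
   [/\ forall t, inc i t -> 0 < lam t, forall t l, inc i t -> 0 < co t l,
       \sum_(t | inc i t) lam t = 1 &
       x = \sum_(t | inc i t) (lam t *: a t + \sum_l co t l *: row l (C t))].

(** The obstruction to a common point: halfspaces containing the hulls, with normals and bounds that
    sum to zero, not all trivial. *)
Definition degenerate (u : J -> 'rV[R]_d) (c : J -> R) :=
  [/\ forall i t, i \in A -> inc i t -> dot (u i) (a t) <= c i /\
        forall l, dot (u i) (row l (C t)) <= 0,
      \sum_(i in A) u i = 0, \sum_(i in A) c i = 0 &
      exists2 i, i \in A & (u i != 0) || (c i != 0)].

(** For each incident pair [e] of a set and a generator, a linear system asks for a common
    homogenized point that uses this generator with coefficient at least [1]. The sum of the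
    solutions uses all generators; for a system without solution, [block_farkas] supplies the
    functionals. *)
Lemma common_point_alternative i0 t0 : i0 \in A -> inc i0 t0 ->
  (exists x, common_point x) \/ (exists u c, degenerate u c).
Proof.
move=> i0A inc0.
pose F := (T + T * 'I_d)%type.
pose ft : F -> T := @gen_ix d T.
pose h : F -> 'rV[R]_(d + 1) := gen a C.
pose g i f := if inc i (ft f) then h f else 0.
pose E0 := [set e : J * F | (e.1 \in A) && inc e.1 (ft e.2)].
pose tau (e : J * F) j := if j == e.1 then - g e.1 e.2 else 0.
pose feas (e : J * F) (w : 'rV[R]_(d + 1) * (J -> F -> R)) :=
  (forall i f, 0 <= w.2 i f) /\
  forall i, i \in A -> \sum_f w.2 i f *: g i f = w.1 *m 1%:M + tau e i.
have [allE|/existsNP[e /not_implyP[eE0 eN]]] :=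
  pselect (forall e, e \in E0 -> exists w, feas e w); last first.
  right; case: (block_farkas A g 1%:M (tau e)) => [[y [co Hco]]|[Psi [Psig Psi0 Psit]]].
    by case: eN; exists (y, co).
  have hE i f : i \in A -> inc i (ft f) -> dot (Psi i) (h f) <= 0.
    by move=> iA iif; have := Psig i f iA; rewrite /g iif.
  have sumPsi : \sum_(i in A) Psi i = 0.
    by apply: dotP => z; rewrite dot0l -(Psi0 z) mulmx1.
  exists (fun i => lsubmx (Psi i)), (fun i => - rsubmx (Psi i) 0 0); split.
  - move=> i t iA it; split.
      by have := hE i (inl t) iA it; rewrite /= dot_lift1 mulr1; lra.
    by move=> l; have := hE i (inr (t, l)) iA it; rewrite /= dot_lift1 mulr0 addr0.
  - by rewrite -(raddf_sum (@lsubmx R 1 d 1)) sumPsi raddf0.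
  - rewrite sumrN -[X in - X](_ : (rsubmx (\sum_(i in A) Psi i)) 0 0 = _).
      by rewrite sumPsi raddf0 mxE oppr0.
    by rewrite (raddf_sum (@rsubmx R 1 d 1)) summxE.
  - move: eE0; rewrite inE => /andP[e1A ince]; exists e.1 => //.
    apply: contraLR Psit; rewrite negb_or !negbK -leNgt oppr_eq0.
    move=> /andP[/eqP l0 /eqP r0]; rewrite (bigD1 e.1)//= big1 ?addr0; last first.
      by move=> j /andP[_ /negPf je]; rewrite /tau je dot0r.
    rewrite /tau eqxx dotNr /g ince oppr_le0.
    have -> : Psi e.1 = 0.
      rewrite -[Psi _]hsubmxK l0 (_ : rsubmx _ = 0) ?row_mx0//.
      by apply/rowP => j; rewrite [j]ord1 r0 mxE.
    by rewrite dot0l.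
left.
have /choice[w Hw] : forall e, exists w, e \in E0 -> feas e w.
  move=> e; have [/allE[w]|] := boolP (e \in E0); first by exists w.
  by exists (0, fun _ _ => 0).
pose Y := \sum_(e in E0) (w e).1.
pose co i f := \sum_(e in E0) (w e).2 i f + 1.
have co_gt0 i f : 0 < co i f.
  by rewrite ltr_wpDl// sumr_ge0// => e /Hw[].
have YE i : i \in A -> Y = \sum_(f | inc i (ft f)) co i f *: h f.
  move=> iA; have -> : Y = \sum_(e in E0) (\sum_f (w e).2 i f *: g i f - tau e i).
    by apply: eq_bigr => e /Hw[_ /(_ i iA)->]; rewrite mulmx1 addrK.
  rewrite sumrB exchange_big /=.
  have -> : \sum_(e in E0) tau e i = - \sum_(f | inc i (ft f)) h f.
    rewrite (eq_bigl (fun e => (e.1 \in A) && inc e.1 (ft e.2))); last first.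
      by move=> e; rewrite inE.
    rewrite -(pair_big_dep (fun j => j \in A) (fun j f => inc j (ft f))
      (fun j f => tau (j, f) i)) /= (bigD1 i)//= [X in _ + X]big1 ?addr0.
      rewrite -sumrN; apply: eq_bigr => f iif.
      by rewrite /tau eqxx /g /= iif.
    by move=> j /andP[_ ji]; apply: big1 => f _; rewrite /tau eq_sym (negPf ji).
  rewrite opprK (bigID (fun f => inc i (ft f))) /= [X in _ + X + _]big1 ?addr0.
    rewrite -big_split; apply: eq_bigr => f iif /=.
    by rewrite /co scalerDl scale1r scaler_suml /g iif.
  by move=> f /negPf nif; apply: big1 => e _; rewrite /g nif scaler0.
have YE' i : i \in A -> Y = lift1
    (\sum_(t | inc i t) (co i (inl t) *: a t +
                         \sum_l co i (inr (t, l)) *: row l (C t)))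
    (\sum_(t | inc i t) co i (inl t)).
  by move=> /YE->; rewrite (gen_sum a C (inc i) (co i)).
pose yl i := \sum_(t | inc i t) co i (inl t).
have ylE i : i \in A -> yl i = yl i0.
  by move=> iA; have := YE' i iA; rewrite (YE' i0 i0A) => /lift1_inj[].
have yl_gt0 : 0 < yl i0.
  by rewrite /yl (bigD1 t0)//= ltr_pwDl// sumr_ge0// => t _; apply: ltW.
exists ((yl i0)^-1 *: lsubmx Y) => i iA.
exists (fun t => co i (inl t) / yl i0), (fun t l => co i (inr (t, l)) / yl i0).
split=> [t _|t l _||]; try exact: divr_gt0.
  by rewrite -mulr_suml -/(yl i) ylE// divff ?gt_eqF.
rewrite (YE' i iA) row_mxKl scaler_sumr; apply: eq_bigr => t _.
rewrite scalerDr scalerA [_^-1 * _]mulrC; congr (_ + _).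
by rewrite scaler_sumr; apply: eq_bigr => l _; rewrite scalerA mulrC.
Qed.

(** Each incident cone enters [x] with a positive weight, so [ray_mix] transfers its rays to [x]. *)
Lemma common_point_ray x i (S : 'rV[R]_d -> Prop) : common_point x -> i \in A ->
  cvx S -> (forall t, inc i t -> S (a t)) ->
  (forall t l, inc i t -> ray (a t) S (row l (C t))) ->
  S x /\ forall t l, inc i t -> ray x S (row l (C t)).
Proof.
move=> cx iA cS Sa Sr; have [lam [co [lam_gt0 co_gt0 lam1 xE]]] := cx i iA.
pose B := [set t | inc i t].
pose b t := a t + \sum_l (co t l / lam t) *: row l (C t).
have Sw t : inc i t -> ray (a t) S (\sum_l (co t l / lam t) *: row l (C t)).
  move=> it; apply: ray_sum => // [|l _|l _]; [exact: Sa| |exact: Sr].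
  by rewrite divr_ge0// ltW// ?co_gt0 ?lam_gt0.
have {}xE : x = \sum_(t in B) lam t *: b t.
  rewrite xE; apply: eq_big => [t|t it]; first by rewrite inE.
  rewrite scalerDr scaler_sumr; congr (_ + _); apply: eq_bigr => l _.
  by rewrite scalerA mulrCA divff ?mulr1// gt_eqF// lam_gt0.
have lam1B : \sum_(t in B) lam t = 1.
  by rewrite -lam1; apply: eq_bigl => t; rewrite inE.
have lam_ge0 t : t \in B -> 0 <= lam t by rewrite inE => /lam_gt0/ltW.
have Sb t : t \in B -> S (b t).
  rewrite inE => it; have := Sw t it 1 ler01.
  by rewrite scale1r.
split; first by rewrite xE; apply: cvx_sum.
move=> t l it; rewrite xE; apply: (ray_mix (t0 := t)) => //.
- by rewrite inE.
- exact: lam_gt0.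
- by apply: ray_shift; [|exact: Sw|exact: Sr].
Qed.

End CommonPoint.

(** * Restriction to a flat *)

Section Flat.
Context (R : realFieldType) (d : nat) (J : finType).
Context (B : {set J}) (u : J -> 'rV[R]_d) (p : 'rV[R]_d).

Definition flat_dim := \rank (kermx (spanm B u)^T).

Definition flat_mx : 'M[R]_(flat_dim, d) := row_base (kermx (spanm B u)^T).

(** [S] in coordinates on the flat through [p] along which every [u b] with [b] in [B] is
    constant. *)
Definition pull (S : 'rV[R]_d -> Prop) (y : 'rV[R]_flat_dim) :=
  S (p + y *m flat_mx).

Lemma flat_dimE : flat_dim = (d - \rank (spanm B u))%N.
Proof. by rewrite /flat_dim mxrank_ker mxrank_tr. Qed.

Lemma flat_mxP m (M : 'M[R]_(m, d)) :
  reflect (forall l b, b \in B -> dot (u b) (row l M) = 0) (M <= flat_mx)%MS.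
Proof.
rewrite eq_row_base; apply: (iffP sub_kermxP) => [M0 l b bB|M0].
  have /submxP[w ->] := spanm_mem u bB.
  by rewrite dotC /dot trmx_mul mulmxA -row_mul M0 row0 mul0mx mxE.
apply/matrixP => l i; rewrite [RHS]mxE.
have /spanmP[th rE] := row_sub i (spanm B u).
transitivity (dot (row l M) (row i (spanm B u))).
  by rewrite dotE mxE; apply: eq_bigr => j _; rewrite !mxE.
by rewrite rE dot_sumr big1// => b bB; rewrite dotZr dotC M0 ?mulr0.
Qed.

Lemma cvx_pull S : cvx S -> cvx (pull S).
Proof.
move=> cS x y t Sx Sy t01; rewrite /pull.
have -> : p + (t *: x + (1 - t) *: y) *m flat_mx =
    t *: (p + x *m flat_mx) + (1 - t) *: (p + y *m flat_mx).
  by rewrite mulmxDl -!scalemxAl !scalerDr [RHS]addrACA -scalerDl (addrC t) subrK scale1r.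
exact: cS.
Qed.

Lemma hascone_push k S : hascone k (pull S) ->
  hascone k (fun x => S x /\ forall b, b \in B -> dot (u b) x = dot (u b) p).
Proof.
have flat y b : b \in B -> dot (u b) (p + y *m flat_mx) = dot (u b) p.
  move=> bB; rewrite dotDr [X in _ + X](_ : _ = 0) ?addr0//.
  have /flat_mxP/(_ 0 b bB) : (y *m flat_mx <= flat_mx)%MS by apply: submxMl.
  by rewrite row_id.
move=> [y [C [Sy kC yC]]].
apply: (@hasconeW _ _ _ _ (p + y *m flat_mx) _ (C *m flat_mx)).
- by split=> // b bB; apply: flat.
- by rewrite mxrankMfree// row_base_free.
- move=> l t t_ge0; rewrite row_mul scalemxAl -addrA -mulmxDl; split.
    exact: yC.
  by move=> b bB; apply: flat.
Qed.

Lemma hascone_pull k S :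
  hascone k (fun x => S x /\ forall b, b \in B -> dot (u b) x = dot (u b) p) ->
  hascone k (pull S).
Proof.
move=> [x [C [[Sx xp] kC xC]]].
have /submxP[y yE] : (x - p <= flat_mx)%MS.
  by apply/flat_mxP => l b bB; rewrite row_id dotBr xp// subrr.
have /submxP[Z ZE] : (C <= flat_mx)%MS.
  apply/flat_mxP => l b bB; have [_ /(_ b bB)] := xC l 1 ler01.
  by rewrite scale1r dotDr xp// => /eqP; rewrite addrC -subr_eq0 addrK => /eqP.
have xE : x = p + y *m flat_mx by rewrite -yE addrCA subrr addr0.
apply: (@hasconeW _ _ _ _ y _ Z); first by rewrite /pull -xE.
  by apply: leq_trans kC _; rewrite ZE mxrankM_maxl.
move=> l t t_ge0; rewrite /pull mulmxDl addrA -xE -scalemxAl -row_mul -ZE.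
by have [] := xC l t t_ge0.
Qed.

End Flat.

(** * Finitely generated cones of directions *)

Section PosCone.
Context (R : realFieldType) (d : nat) (T : finType) (P : pred T).
Context (C : T -> 'M[R]_d).

Definition pos_cone (v : 'rV[R]_d) := exists2 co : T -> 'I_d -> R,
  forall t l, 0 <= co t l & v = \sum_(t | P t) \sum_l co t l *: row l (C t).

Lemma pos_coneZ a v : 0 <= a -> pos_cone v -> pos_cone (a *: v).
Proof.
move=> a_ge0 [co co_ge0 ->]; exists (fun t l => a * co t l) => [t l|].
  exact: mulr_ge0.
rewrite scaler_sumr; apply: eq_bigr => t _.
by rewrite scaler_sumr; apply: eq_bigr => l _; rewrite scalerA.
Qed.

Lemma pos_coneD v w : pos_cone v -> pos_cone w -> pos_cone (v + w).
Proof.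
move=> [co co_ge0 ->] [co' co'_ge0 ->].
exists (fun t l => co t l + co' t l) => [t l|]; first exact: addr_ge0.
rewrite -big_split; apply: eq_bigr => t _ /=.
by rewrite -big_split; apply: eq_bigr => l _; rewrite scalerDl.
Qed.

Lemma pos_cone0 : pos_cone 0.
Proof.
exists (fun _ _ => 0) => //; rewrite big1// => t _.
by rewrite big1// => l _; rewrite scale0r.
Qed.

Lemma cvx_pos_cone : cvx pos_cone.
Proof.
move=> v w t Pv Pw /andP[t0 t1].
by apply: pos_coneD; apply: pos_coneZ => //; rewrite subr_ge0.
Qed.

Lemma pos_cone_row t l : P t -> pos_cone (row l (C t)).
Proof.
move=> Pt; exists (fun s i => ((s == t) && (i == l))%:R) => [s i|].
  exact: ler0n.
rewrite (bigD1 t)//= (bigD1 l)//= !eqxx scale1r [X in _ + X + _]big1 ?addr0.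
  rewrite [X in _ + X]big1 ?addr0// => s /andP[_ /negPf st].
  by apply: big1 => i _; rewrite st scale0r.
by move=> i /negPf il; rewrite il andbF scale0r.
Qed.

Lemma pos_cone_ray (S : 'rV[R]_d -> Prop) y v : cvx S -> S y ->
  (forall t l, P t -> ray y S (row l (C t))) -> pos_cone v -> ray y S v.
Proof.
move=> cS Sy yr [co co_ge0 ->]; apply: big_ind => [t _|v1 v2|t Pt].
- by rewrite scaler0 addr0.
- exact: rayD.
- by apply: ray_sum => // l _; apply: yr.
Qed.

(** A functional separating [v] from the cone would be nonpositive on the cone, yet tend to infinity
    along the ray. *)
Lemma pos_cone_closed p v : ray p pos_cone v -> pos_cone v.
Proof.
move=> pv; pose s (e : T * 'I_d) := if P e.1 then row e.2 (C e.1) else 0.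
have [[lam lam_ge0 ->]|[z zs zv]] := cone_farkas (@dotC R _) (@dotDl R _)
    (@dotZl R _) (@dot_ge0 R _) (@dot_eq0 R _) s v.
  exists (fun t l => lam (t, l)) => [t l|]; first exact: lam_ge0.
  rewrite (eq_bigr (fun e => lam (e.1, e.2) *: s (e.1, e.2))); last by case.
  rewrite -(pair_bigA _ (fun t l => lam (t, l) *: s (t, l))) /= [RHS]big_mkcond.
  apply: eq_bigr => t _; rewrite /s /=; case: (P t) => //.
  by apply: big1 => l _; rewrite scaler0.
exfalso; have [co co_ge0 qE] := pv (`|dot z p| / dot z v + 1)
    (addr_ge0 (divr_ge0 (normr_ge0 _) (ltW zv)) ler01).
have : dot z (p + (`|dot z p| / dot z v + 1) *: v) <= 0.
  rewrite qE dot_sumr sumr_le0// => t Pt; rewrite dot_sumr sumr_le0// => l _.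
  by rewrite dotZr mulr_ge0_le0//; have := zs (t, l); rewrite /s /= Pt.
rewrite dotDr dotZr mulrDl divfK ?mul1r ?gt_eqF//.
by have := ler_norm (- dot z p); rewrite normrN; lra.
Qed.

(** Positive coefficients put [x] in the relative interior of the cone, so a large multiple of it
    compensates any vector of the span. *)
Lemma pos_cone_absorb x (co : T -> 'I_d -> R) v :
  (forall t l, P t -> 0 < co t l) ->
  x = \sum_(t | P t) \sum_l co t l *: row l (C t) ->
  (v <= \sum_(t | P t) <<C t>>)%MS ->
  exists2 m, 0 <= m & forall M, m <= M -> pos_cone (M *: x + v).
Proof.
move=> co_gt0 xE /sub_sumsmxP[q vE].
have /choice[q' q'E] : forall t, exists w, q t *m <<C t>>%MS = w *m C t.
  by move=> t; apply/submxP; rewrite (submx_trans (submxMl _ _))// genmxE.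
pose m := \sum_(t | P t) \sum_l `|q' t 0 l| / co t l.
have m_ge0 : 0 <= m.
  apply: sumr_ge0 => t Pt; apply: sumr_ge0 => l _.
  by rewrite divr_ge0// ltW// co_gt0.
exists m => // M mM.
exists (fun t l => if P t then M * co t l + q' t 0 l else 0) => [t l|].
  case: ifP => // Pt.
  have le_m : `|q' t 0 l| / co t l <= M.
    apply: le_trans mM; rewrite /m (bigD1 t)//= (bigD1 l)//= -addrA lerDl.
    rewrite addr_ge0 ?sumr_ge0// => [i _|s /andP[Ps _]].
      by rewrite divr_ge0// ltW// co_gt0.
    by apply: sumr_ge0 => i _; rewrite divr_ge0// ltW// co_gt0.
  move: le_m; rewrite ler_pdivrMr ?co_gt0//.
  by have := ler_norm (- q' t 0 l); rewrite normrN; lra.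
rewrite xE vE scaler_sumr -big_split; apply: eq_bigr => t Pt /=.
rewrite Pt q'E mulmx_sum_row scaler_sumr -big_split; apply: eq_bigr => l _ /=.
by rewrite scalerDl scalerA.
Qed.

End PosCone.

(** * Finite certificates for a single family *)

Section Certificate.
Context (R : realFieldType) (d k : nat) (T K : finType) (k0 : K).
Context (col : T -> K) (x : T -> 'rV[R]_d) (C : T -> 'M[R]_d).
Context (S : K -> 'rV[R]_d -> Prop).
Hypothesis cS : forall j, cvx (S j).
Hypothesis Sx : forall t, S (col t) (x t).
Hypothesis Sray : forall t t' l, col t = col t' ->
  ray (x t) (S (col t)) (row l (C t')).

(** If nonempty, the intersection of the polyhedra generated by the points [x t] and the rows of the
    [C t], one for each [j], has this recession cone. *)
#[local] Definition rec_cone (v : 'rV[R]_d) :=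
  forall j, pos_cone (fun t => col t == j) C v.

#[local] Definition hull_bound (u : 'rV[R]_d) (c : R) (j : K) :=
  forall t, col t = j -> dot u (x t) <= c /\
    forall l, dot u (row l (C t)) <= 0.

#[local] Definition infeasible := exists (u : K -> 'rV[R]_d) (c : K -> R),
  [/\ forall j, hull_bound (u j) (c j) j, \sum_j u j = 0 & \sum_j c j < 0].

#[local] Lemma hull_point : infeasible \/
  exists y, forall j, S j y /\ forall t l, col t = j -> ray y (S j) (row l (C t)).
Proof.
pose g (j : K) f := if col (gen_ix f) == j then gen x C f else 0.
(* The zero last column and the offset [lift1 0 1] force the weights of the points to sum to [1] in
   each block. *)
pose D : 'M[R]_(d, d + 1) := row_mx 1%:M 0.
have DE y : y *m D = lift1 y 0 by rewrite mul_mx_row mulmx1 mulmx0 /lift1 raddf0.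
have [[y [co [co_ge0 coE]]]|[Psi [Psig Psi0 Psit]]] :=
  block_farkas [set: K] g D (fun=> lift1 0 1); last first.
  left; exists (fun j => lsubmx (Psi j)), (fun j => - rsubmx (Psi j) 0 0).
  split.
  - move=> j t tj; split.
      have := Psig j (inl t) (in_setT _); rewrite /g /= tj eqxx dot_lift1 mulr1; lra.
    move=> l; have := Psig j (inr (t, l)) (in_setT _).
    by rewrite /g /= tj eqxx dot_lift1 mulr0 addr0.
  - apply: dotP => z; rewrite dot0l -(Psi0 z) DE dot_suml [RHS]dot_suml.
    apply: eq_big => [j|j _]; first by rewrite inE.
    by rewrite dot_lift1 mulr0 addr0.
  - move: Psit; rewrite sumrN oppr_lt0; congr (_ < _); apply: eq_big => [j|j _].
      by rewrite inE.
    by rewrite dot_lift1 dot0r add0r mulr1.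
right; exists y => j.
have /esym := coE j (in_setT j); rewrite DE.
have -> : lift1 y 0 + lift1 0 1 = lift1 y 1.
  by rewrite /lift1 add_row_mx addr0 raddf0 add0r.
rewrite (bigID (fun f => col (gen_ix f) == j)) /= [X in _ = _ + X]big1 ?addr0; last first.
  by move=> f /negPf fj; rewrite /g fj scaler0.
rewrite (eq_bigr (fun f => co j f *: gen x C f)); last by move=> f; rewrite /g => ->.
rewrite (gen_sum x C (fun t => col t == j) (co j)).
move=> /lift1_inj[yE /esym co1].
pose B := [set t | col t == j].
have co1B : \sum_(t in B) co j (inl t) = 1.
  by rewrite -co1; apply: eq_bigl => t; rewrite inE.
have BS t : t \in B -> S j (x t) by rewrite inE => /eqP <-.
pose q := \sum_(t in B) co j (inl t) *: x t.
have Sq : S j q by apply: cvx_sum.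
have qray t l : col t = j -> ray q (S j) (row l (C t)).
  move=> tj; have [t0 t0B cot0] : exists2 t0, t0 \in B & 0 < co j (inl t0).
    apply: contrapT => nex; move/eqP: co1B; rewrite big1 ?oner_eq0// 1?eq_sym ?oner_eq0//.
    move=> s sB; apply/eqP; rewrite eq_le co_ge0 andbT leNgt; apply/negP => cos.
    by apply: nex; exists s.
  apply: (ray_mix (t0 := t0)) => //.
  move: t0B; rewrite inE => /eqP t0j; rewrite -t0j.
  by apply: Sray; rewrite t0j tj.
pose w := \sum_(t in B) \sum_l co j (inr (t, l)) *: row l (C t).
have wray : ray q (S j) w.
  apply: big_ind => [t _|v1 v2|t]; first by rewrite scaler0 addr0.
    exact: rayD.
  by rewrite inE => /eqP tj; apply: ray_sum => // l _; apply: qray.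
have {}yE : y = q + w.
  by rewrite yE big_split; congr (_ + _); apply: eq_bigl => t; rewrite inE.
split; first by have := wray 1 ler01; rewrite scale1r -yE.
by move=> t l tj; rewrite yE; apply: ray_shift => //; apply: qray.
Qed.

(* [Y] spans the orthogonal complement of the common recession cone; its rows
   and their opposites are sums of normals of the sets. *)
#[local] Lemma recession_certificate : (k <= d)%N ->
  (forall m (M : 'M[R]_(m, d)),
     (forall l, rec_cone (row l M)) -> (\rank M < k)%N) ->
  exists U : K -> 'I_d * bool -> 'rV[R]_d,
  [/\ forall j e t l, col t = j -> dot (U j e) (row l (C t)) <= 0,
      \sum_j \sum_e U j e = 0 &
      exists Y : 'M[R]_d, (d + 1 - k <= \rank Y)%N /\
        forall l, row l Y = \sum_j U j (l, false)].
Proof.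
move=> kd Xsmall.
have [m [M [XM XM']]] := spanning_rows rec_cone.
have rho_k := Xsmall _ _ XM.
pose Y := kermx M^T.
have rY : (d + 1 - k <= \rank Y)%N.
  by rewrite mxrank_ker mxrank_tr; lia.
have orthY v l : rec_cone v -> dot v (row l Y) = 0.
  move=> /XM'/submxP[w ->]; rewrite dotC /dot trmx_mul mulmxA -row_mul.
  by rewrite mulmx_ker row0 mul0mx mxE.
have dec (e : 'I_d * bool) : exists U : K -> 'rV[R]_d,
    (forall j t l, col t = j -> dot (U j) (row l (C t)) <= 0) /\
    \sum_j U j = (-1) ^+ e.2 *: row e.1 Y.
  set y := _ *: _.
  pose g (j : K) (f : T * 'I_d) :=
    if col f.1 == j then lift1 (row f.2 (C f.1)) 0 else 0.
  (* The last coordinate of [z *m D] is [dot z y], and the offset forces it to be [1]: a solution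
     would be a recession vector not orthogonal to [y]. *)
  pose D : 'M[R]_(d, d + 1) := row_mx 1%:M y^T.
  have DE z : z *m D = lift1 z (dot z y).
    by rewrite mul_mx_row mulmx1 /lift1; congr row_mx; rewrite -mx11_scalar.
  have [[z [co [co_ge0 coE]]]|[Psi [Psig Psi0 Psit]]] :=
    block_farkas [set: K] g D (fun=> lift1 0 (-1)).
    exfalso; have coE' j : z = \sum_(t | col t == j) \sum_l co j (t, l) *: row l (C t)
        /\ dot z y = 1.
      have := coE j (in_setT j); rewrite DE.
      have -> : lift1 z (dot z y) + lift1 0 (-1) = lift1 z (dot z y - 1).
        by rewrite /lift1 add_row_mx addr0 -raddfD.
      rewrite (bigID (fun f => col f.1 == j)) /= [X in _ + X]big1 ?addr0; last first.
        by move=> f /negPf fj; rewrite /g fj scaler0.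
      rewrite (eq_bigr (fun f => co j f *: lift1 (row f.2 (C f.1)) 0)); last first.
        by move=> f; rewrite /g => ->.
      rewrite lift1_sum => /lift1_inj[zE]; rewrite big1 => [yE|f _]; last first.
        by rewrite mulr0.
      split; last by move/eqP: yE; rewrite eq_sym subr_eq0 => /eqP.
      rewrite pair_big_dep -zE /=; apply: eq_big => [[t l]|[t l] _//] /=.
      by rewrite andbT.
    have Xz : rec_cone z by move=> j; exists (fun t l => co j (t, l)) => //; apply: (coE' j).1.
    have := (coE' k0).2; rewrite /y dotZr orthY// mulr0 => /esym/eqP.
    by rewrite oner_eq0.
  pose be := - \sum_j rsubmx (Psi j) 0 0.
  have be_gt0 : 0 < be.
    move: Psit; congr (_ < _); rewrite /be -sumrN; apply: eq_big => [j|j _].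
      by rewrite inE.
    by rewrite dot_lift1 dot0r add0r mulrN1.
  exists (fun j => be^-1 *: lsubmx (Psi j)); split.
    move=> j t l tj; rewrite dotZl; apply: mulr_ge0_le0.
      by rewrite invr_ge0 ltW.
    have := Psig j (t, l) (in_setT _).
    by rewrite /g /= tj eqxx dot_lift1 mulr0 addr0.
  rewrite -scaler_sumr; suff -> : \sum_j lsubmx (Psi j) = be *: y.
    by rewrite scalerA mulVf ?scale1r// gt_eqF.
  apply: dotP => z; have := Psi0 z; rewrite DE dot_suml => PsiS.
  apply/eqP; rewrite -subr_eq0 -[X in _ == X]PsiS dotZl /be mulNr opprK.
  rewrite dot_suml mulr_suml -big_split /=; apply/eqP; apply: eq_big => [j|j _].
    by rewrite inE.
  by rewrite dot_lift1 (dotC z).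
have /choice[U /all_and2[U_le0 UE]] := dec.
exists (fun j e => U e j); split=> [j e t l|| ]; first exact: U_le0.
- rewrite exchange_big /=; under eq_bigr do rewrite UE.
  rewrite -(pair_bigA _ (fun l (b : bool) => (-1) ^+ b *: row l Y)) /= big1// => l _.
  by rewrite big_bool /= scale1r scaleN1r addNr.
- by exists Y; split=> // l; rewrite UE scale1r.
Qed.

(** Both kinds of certificate share one finite index type, as a rainbow will select from it: [None]
    carries the infeasibility functionals, [Some (l, b)] those that sum to the [l]-th row of [Y]
    with sign [b]. *)
Lemma hull_certificate : (k <= d)%N ->
  hascone k (fun y => forall j, S j y) \/
  exists (u : K * option ('I_d * bool) -> 'rV[R]_d)
         (c lam : K * option ('I_d * bool) -> R),
  [/\ forall e t, col t = e.1 -> dot (u e) (x t) <= c e /\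
        forall l, dot (u e) (row l (C t)) <= 0,
      forall e, 0 <= lam e, \sum_e lam e *: u e = 0 &
      \sum_e lam e * c e < 0 \/
      (d + 1 - k <= \rank (spanm [set e | (0 < lam e)%R] u))%N].
Proof.
move=> kd; have [[u [c [uc u0 c0]]]|[y Hy]] := hull_point.
  right; exists (fun e => u e.1), (fun e => c e.1), (fun e => (e.2 == None)%:R).
  have pairE (V : zmodType) (f : K * option ('I_d * bool) -> V) :
      (forall j e, f (j, Some e) = 0) -> \sum_e f e = \sum_j f (j, None).
    move=> f0; rewrite (eq_bigr (fun e => f (e.1, e.2))); last by case.
    rewrite -(pair_bigA _ (fun j e => f (j, e))) /=; apply: eq_bigr => j _.
    by rewrite (bigD1 None)//= big1 ?addr0// => -[e|//] _; apply: f0.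
  split=> [e t te|e||]; [exact: uc|exact: ler0n| |left].
    rewrite pairE => [|j e]; last by rewrite scale0r.
    by rewrite -[RHS]u0; apply: eq_bigr => j _; rewrite scale1r.
  rewrite pairE => [|j e]; last by rewrite mul0r.
  by move: c0; congr (_ < _); apply: eq_bigr => j _; rewrite mul1r.
have [|nocone] := pselect (hascone k (fun y => forall j, S j y)); first by left.
have [|U [U_le0 U0 [Y [rY YE]]]] := recession_certificate kd.
  move=> m M XM; rewrite ltnNge; apply/negP => kM; apply: nocone.
  apply: (@hasconeW _ _ _ _ y _ M) => // [j|l t t_ge0 j]; first exact: (Hy j).1.
  have [Sy yr] := Hy j; apply: (pos_cone_ray _ _ _ (XM l j)) => //.
  by move=> t' l' /eqP; apply: yr.
right; pose u (e : K * option ('I_d * bool)) :=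
  if e.2 is Some f then U e.1 f else 0.
exists u, (fun e => \sum_t `|dot (u e) (x t)|), (fun=> 1); split=> //.
- move=> [j o] t /= tj; split.
    rewrite (bigD1 t)//= (le_trans (ler_norm _))// lerDl.
    by apply: sumr_ge0 => s _; apply: normr_ge0.
  by move=> l; rewrite /u /=; case: o => [e|]; [exact: U_le0|rewrite dot0l].
- rewrite (eq_bigr (fun e => u (e.1, e.2))); last by case=> j o; rewrite scale1r.
  rewrite -(pair_bigA _ (fun j e => u (j, e))) /= -[RHS]U0.
  apply: eq_bigr => j _; rewrite (bigD1 None)//= /u /= add0r.
  rewrite (reindex_omap Some id) /=; last by case=> [e|].
  by apply: eq_bigl => e; rewrite eqxx.
- right; apply: leq_trans rY _; apply: mxrankS; apply/row_subP => l.
  rewrite YE; apply: summx_sub => j _.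
  by apply: (spanm_mem u (t := (j, Some (l, false)))); rewrite inE ltr01.
Qed.

End Certificate.

Lemma weighted_sum_eq0 (R : realFieldType) (T : finType) (A : {set T})
    (mu f : T -> R) : (forall t, t \in A -> 0 < mu t) ->
  (forall t, t \in A -> f t <= 0) -> \sum_(t in A) mu t * f t = 0 ->
  forall t, t \in A -> f t = 0.
Proof.
move=> mu_gt0 f_le0 /eqP; rewrite -oppr_eq0 -sumrN psumr_eq0 => [|t tA].
  move=> /allP f0 t tA; have := f0 t (mem_index_enum _).
  by rewrite tA oppr_eq0 mulf_eq0 gt_eqF ?mu_gt0//= => /eqP.
by rewrite oppr_ge0 mulr_ge0_le0 ?f_le0// ltW// mu_gt0.
Qed.

(** Complementary slackness: a positive combination of the functionals vanishes together with its
    bound, and each respects its bound on a cone incident to all of [B]; so every bound is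
    attained. *)
Lemma degenerate_tight (R : realFieldType) (d : nat) (T J : finType)
    (A B : {set J}) (inc : J -> T -> bool) (a : T -> 'rV[R]_d)
    (C : T -> 'M[R]_d) u c (mu : J -> R) t :
  degenerate A inc a C u c -> B \subset A -> (forall b, b \in B -> 0 < mu b) ->
  \sum_(b in B) mu b *: u b = 0 -> \sum_(b in B) mu b * c b = 0 ->
  (forall b, b \in B -> inc b t) ->
  forall b, b \in B -> dot (u b) (a t) = c b /\
    forall l, dot (u b) (row l (C t)) = 0.
Proof.
move=> [uc _ _ _] BA mu_gt0 muu muc bt b bB; split=> [|l].
  apply/eqP; rewrite -subr_eq0; apply/eqP; move: b bB.
  apply: (weighted_sum_eq0 mu_gt0) => [b bB|].
    by rewrite subr_le0; apply: (uc b t _ (bt b bB)).1; apply: (subsetP BA).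
  under eq_bigr do rewrite mulrBr -dotZl.
  by rewrite sumrB -dot_suml muu dot0l muc subr0.
move: b bB; apply: (weighted_sum_eq0 mu_gt0) => [b bB|].
  by apply: (uc b t _ (bt b bB)).2; apply: (subsetP BA).
under eq_bigr do rewrite -dotZl.
by rewrite -dot_suml muu dot0l.
Qed.

Lemma rank_orth (R : realFieldType) (d : nat) (J : finType) (B : {set J})
    (u : J -> 'rV[R]_d) m (M : 'M_(m, d)) :
  (forall l b, b \in B -> dot (u b) (row l M) = 0) ->
  (\rank M + \rank (spanm B u) <= d)%N.
Proof.
move=> M0; have /mxrankS : (M <= flat_mx B u)%MS by apply/flat_mxP.
rewrite [X in (_ <= X)%N -> _](eqnP (row_base_free _)) -/(flat_dim B u) flat_dimE.
by have := rank_leq_col (spanm B u); lia.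
Qed.

(** * Full rainbows *)

Lemma colourful_cones (R : realFieldType) (d k : nat) (I K : finType) (k0 : K)
    (A : {set I}) (G : I -> K -> 'rV[R]_d -> Prop) :
  (forall i j, i \in A -> cvx (G i j)) -> (2 * d + 1 <= #|A| + k)%N ->
  (forall s : {ffun I -> K}, hascone k (fun x => forall i, i \in A -> G i (s i) x)) ->
  exists2 i, i \in A & hascone k (fun x => forall j, G i j x).
Proof.
have [m] := ubnP d; elim: m => // m IH in d A G *.
move=> /ltnSE-dm cG Ak Hs.
have kd : (k <= d)%N.
  by have [p [C [_ kC _]]] := Hs [ffun=> k0]; apply: leq_trans kC (rank_leq_col C).
have [i0 i0A] : exists i, i \in A by apply/card_gt0P; lia.
have /choice[a /choice[C HC]] := Hs.
have Ga (s : {ffun I -> K}) i : i \in A -> G i (s i) (a s) by have [+ _ _] := HC s; apply.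
have GC (s : {ffun I -> K}) l i : i \in A -> ray (a s) (G i (s i)) (row l (C s)).
  by move=> iA t t_ge0; have [_ _ /(_ l t t_ge0)] := HC s; apply.
(* The hull of colour [i] for the rainbow [s] is spanned by the cones of all rainbows that share its
   set of colour [i]. *)
pose inc (s : {ffun I -> K}) i (t : {ffun I -> K}) := t i == s i.
have [allx|/existsNP[s sN]] :=
  pselect (forall s, exists x, common_point A (inc s) a C x); last first.
  have [//|[u [c deg]]] :=
    @common_point_alternative R d _ _ A (inc s) a C i0 s i0A (eqxx _).
  have [uc u0 c0 [i1 i1A i1N]] := deg.
  have one_gt0 i : i \in A -> 0 < (1 : R) by rewrite ltr01.
  have tightA : forall i, i \in A -> dot (u i) (a s) = c i.
    move=> i iA; apply: (degenerate_tight (mu := fun=> 1) deg (subxx A) one_gt0 _ _ _ iA).1.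
    - by under eq_bigr do rewrite scale1r.
    - by under eq_bigr do rewrite mul1r.
    - by move=> b _; apply: eqxx.
  pose X0 := [set i in A | u i != 0].
  have X0A : X0 \subset A by apply/subsetP => i; rewrite inE => /andP[].
  have i1X : i1 \in X0.
    rewrite inE i1A; apply: contraTneq i1N => ui1.
    by rewrite negb_or !negbK -tightA// ui1 dot0l !eqxx.
  have [||B [mu [BX B2 mu_gt0 mu0 Brk]]] :=
      @circuit R I d X0 u (fun=> 1) i1 i1X (fun _ _ => ltr01).
  - by move=> i; rewrite inE => /andP[].
  - rewrite -[RHS]u0 [RHS](big_setID X0) /= (setIidPr X0A) [X in _ = _ + X]big1 ?addr0.
      by apply: eq_bigr => i _; rewrite scale1r.
    move=> i; rewrite !inE => /andP[+ iA].
    by rewrite iA /= negbK => /eqP.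
  have BA : B \subset A := subset_trans BX X0A.
  have muc : \sum_(b in B) mu b * c b = 0.
    rewrite (eq_bigr (fun b => dot (mu b *: u b) (a s))) => [|b bB].
      by rewrite -dot_suml mu0 dot0l.
    by rewrite dotZl tightA// (subsetP BA).
  (* Passing to the flat lowers [2 * d] by [2 * w] and the number of colours by at most [w + 1],
     where [w >= 1] is the rank of the circuit; so the inequality between them persists. *)
  have fdE := flat_dimE B u.
  have rkd := rank_leq_col (spanm B u).
  have BAc : #|A :\: B| = (#|A| - #|B|)%N by rewrite cardsD (setIidPr BA).
  have [||||i iAB Hi] := IH (flat_dim B u) (A :\: B)
      (fun i j => @pull _ _ _ B u (a s) (G i j)).
  - by move: dm B2 Brk; rewrite fdE; lia.
  - by move=> i j; rewrite inE => /andP[_ iA]; apply: cvx_pull; apply: cG.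
  - by move: B2 Brk Ak; rewrite fdE BAc; have := subset_leq_card BA; lia.
  (* The choice of [s] is kept on [B], so that the cone of [t] is tight there and lies in the
     flat. *)
  - move=> s'; pose t : {ffun I -> K} := [ffun i => if i \in B then s i else s' i].
    have tB b : b \in B -> inc s b t by move=> bB; rewrite /inc ffunE bB.
    have tight_t := degenerate_tight deg BA mu_gt0 mu0 muc tB.
    apply: (@hascone_pull _ _ _ _ _ _ _
      (fun x => forall i, i \in A :\: B -> G i (s' i) x)).
    have ts' i : i \in A :\: B -> i \in A /\ t i = s' i.
      by rewrite inE => /andP[/negPf iB iA]; rewrite ffunE iB.
    exists (a t), (C t); split; [split| |] => [i iAB|b bB||l e e_ge0].
    + by have [iA <-] := ts' i iAB; apply: Ga.
    + by rewrite (tight_t b bB).1 tightA// (subsetP BA).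
    + by have [] := HC t.
    + split=> [i iAB|b bB].
        by have [iA <-] := ts' i iAB; apply: GC.
      have [t1 t2] := tight_t b bB.
      by rewrite dotDr dotZr t2 mulr0 addr0 t1 tightA// (subsetP BA).
  - exists i; first by move: iAB; rewrite inE => /andP[].
    have := @hascone_push _ _ _ B u (a s) k (fun x => forall j, G i j x) Hi.
    by apply: hasconeS => x [Gx _]; exact: Gx.
have /choice[x Hx] := allx.
have HG (s : {ffun I -> K}) i : i \in A -> G i (s i) (x s) /\
    forall t l, inc s i t -> ray (x s) (G i (s i)) (row l (C t)).
  move=> iA; apply: (common_point_ray (Hx s) iA); first exact: cG.
    by move=> t /eqP <-; apply: Ga.
  by move=> t l /eqP <-; apply: GC.
apply: contrapT => nex.
(* The common points [x t] replace the apexes: from them, all rays of the cones that share the set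
   stay in it, as [hull_certificate] requires. *)
have /choice[w Hw] : forall i, exists w :
    (K * option ('I_d * bool) -> 'rV[R]_d) *
    ((K * option ('I_d * bool) -> R) * (K * option ('I_d * bool) -> R)),
  i \in A -> [/\ forall e (t : {ffun I -> K}), t i = e.1 ->
        dot (w.1 e) (x t) <= w.2.1 e /\
        forall l, dot (w.1 e) (row l (C t)) <= 0,
      forall e, 0 <= w.2.2 e, \sum_e w.2.2 e *: w.1 e = 0 &
      \sum_e w.2.2 e * w.2.1 e < 0 \/
      (d + 1 - k <= \rank (spanm [set e | (0 < w.2.2 e)%R] w.1))%N].
  move=> i; have [iA|iA] := boolP (i \in A); last by exists (fun=> 0, (fun=> 0, fun=> 0)).
  have [||||Hi|[u [c [lam Hi]]]] :=
    @hull_certificate R d k _ K k0 (fun t : {ffun I -> K} => t i) x C (G i).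
  - by move=> j; apply: cG.
  - by move=> t; apply: (HG t i iA).1.
  - by move=> t t' l tt'; apply: (HG t i iA).2; rewrite /inc tt'.
  - exact: kd.
  - by case: nex; exists i.
  - by exists (u, (c, lam)).
pose u i := (w i).1; pose c i := (w i).2.1.
pose sg (s : {ffun I -> K * option ('I_d * bool)}) : {ffun I -> K} :=
  [ffun i => (s i).1].
have Hu (s : {ffun I -> K * option ('I_d * bool)}) i : i \in A ->
    dot (u i (s i)) (x (sg s)) <= c i (s i) /\
    forall l, dot (u i (s i)) (row l (C (sg s))) <= 0.
  by move=> iA; have [+ _ _ _] := Hw i iA; apply; rewrite ffunE.
have [|||s [J [lam [JA lam_gt0 lam0 rJ]]]] :=
    @rainbow_lineality R I _ d A u c (d + 1 - k) _ (k0, None).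
- move=> s J lam JA lam_ge0 lam0.
  have : dot (\sum_(i in J) lam i *: u i (s i)) (x (sg s)) <=
      \sum_(i in J) lam i * c i (s i).
    rewrite dot_suml; apply: ler_sum => i iJ; rewrite dotZl.
    by rewrite ler_wpM2l ?lam_ge0//; apply: (Hu s i _).1; apply: (subsetP JA).
  by rewrite lam0 dot0l.
- by move: Ak; lia.
- by move=> i iA; have [_ H1 H2 H3] := Hw i iA; exists (w i).2.2.
(* The normals on [J] span at least [d + 1 - k] dimensions, but annihilate the cone of the rainbow
   [sg s], which has rank at least [k]. *)
have Corth l b : b \in J -> dot (u b (s b)) (row l (C (sg s))) = 0.
  move: b; apply: (weighted_sum_eq0 lam_gt0) => [b bJ|].
    by apply: (Hu s b _).2; apply: (subsetP JA).
  under eq_bigr do rewrite -dotZl.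
  by rewrite -dot_suml lam0 dot0l.
have := rank_orth Corth; have [_ kC _] := HC (sg s).
by move: kC rJ kd; lia.
Qed.

(** * Katchalski's theorem *)

(** Otherwise Farkas' lemma gives [y] with negative sums [\sum_(i in B) y i * M i j]. Subtracting
    [c * mu i] from [y i], where [c = y b / mu b] is the largest ratio, keeps the sum for column [b]
    but makes all its terms nonnegative. *)
Lemma zmatrix_right_kernel (R : realFieldType) (J : finType) (B : {set J})
    (M : J -> J -> R) (mu : J -> R) j0 : j0 \in B ->
  (forall i j, i \in B -> j \in B -> i != j -> M i j <= 0) ->
  (forall i, i \in B -> 0 < mu i) ->
  (forall j, j \in B -> \sum_(i in B) mu i * M i j = 0) ->
  exists nu : J -> R, [/\ forall j, j \in B -> 0 <= nu j,
    \sum_(j in B) nu j = 1 & forall i, i \in B -> \sum_(j in B) nu j * M i j = 0].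
Proof.
move=> j0B M_le0 mu_gt0 muM.
pose v j : 'rV[R]_#|J| := \row_l (if enum_val l \in B then M (enum_val l) j else 0).
pose s j := if j \in B then lift1 (v j) 1 else 0.
have sumB (V : zmodType) (f : J -> V) :
    \sum_(l < #|J|) f (enum_val l) = \sum_i f i.
  by rewrite [RHS](reindex _ (onW_bij _ (@enum_val_bij J))).
have [[lam lam_ge0 lamE]|[z zs zp]] := cone_farkas (@dotC R _) (@dotDl R _)
    (@dotZl R _) (@dot_ge0 R _) (@dot_eq0 R _) s (lift1 0 1).
  move: lamE; rewrite (bigID (fun j => j \in B)) /= [X in _ + X]big1 ?addr0; last first.
    by move=> j /negPf jB; rewrite /s jB scaler0.
  rewrite (eq_bigr (fun j => lam j *: lift1 (v j) 1)); last by move=> j jB; rewrite /s jB.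
  rewrite lift1_sum => /lift1_inj[v0 lam1]; exists lam; split=> // [|i iB].
    by rewrite [RHS]lam1; apply: eq_bigr => j _; rewrite mulr1.
  move/rowP/(_ (enum_rank i)): v0; rewrite mxE summxE => v0; rewrite [RHS]v0.
  by apply: eq_bigr => j _; rewrite !mxE enum_rankK iB.
exfalso; pose y i := lsubmx z 0 (enum_rank i); pose t := rsubmx z 0 0.
have t_gt0 : 0 < t by move: zp; rewrite dot_lift1 dot0r add0r mulr1.
have yM j : j \in B -> \sum_(i in B) y i * M i j < 0.
  move=> jB; have := zs j; rewrite /s jB dot_lift1 mulr1 -/t.
  suff -> : dot (lsubmx z) (v j) = \sum_(i in B) y i * M i j by move: t_gt0; lra.
  rewrite dotE [RHS]big_mkcond -[RHS]sumB; apply: eq_bigr => l _.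
  by rewrite [v j _ _]mxE /y enum_valK; case: ifP => _; rewrite ?mulr0.
have [b bB maxb] : exists2 b, b \in B & forall i, i \in B -> y i / mu i <= y b / mu b.
  by case: (arg_maxP (fun i => y i / mu i) j0B) => b bB maxb; exists b.
pose c := y b / mu b.
have : 0 <= \sum_(i in B) (y i - c * mu i) * M i b.
  apply: sumr_ge0 => i iB; have [->|ib] := eqVneq i b.
    by rewrite /c divfK ?subrr ?mul0r// gt_eqF// mu_gt0.
  rewrite mulr_le0 ?M_le0// subr_le0 -ler_pdivrMr ?mu_gt0//.
  exact: maxb.
under eq_bigr do rewrite mulrBl -mulrA.
by rewrite sumrB -mulr_sumr muM// mulr0 subr0 leNgt yM.
Qed.

(* The second alternative carries the induction on [d]: a large minimal family
   has a small common recession cone. *)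
Definition katchalski (R : realFieldType) (k d : nat) :=
  forall (J : finType) (A : {set J}) (S : J -> 'rV[R]_d -> Prop),
  (forall i, i \in A -> cvx (S i)) -> (k <= d)%N ->
  (forall j, j \in A -> hascone k (fun x => forall i, i \in A :\ j -> S i x)) ->
  ~ hascone k (fun x => forall i, i \in A -> S i x) ->
  (#|A| <= 2 * (d - k + 1))%N \/
  ((#|A| <= d + 1)%N /\
   ~ hascone (d + 2 - #|A|) (fun x => forall i, i \in A -> S i x)).

(** * Large minimal families with separated hulls *)

Section Degenerate.
Context (R : realFieldType) (k d : nat) (J : finType) (A : {set J}).
Context (S : J -> 'rV[R]_d -> Prop) (flag : bool).
Context (a : option J -> 'rV[R]_d) (C : option J -> 'M[R]_d).

(* [None] labels an extra cone contained in all the sets; it is present only if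
   [flag] holds. *)
Definition others i (t : option J) :=
  if t is Some j then (j \in A) && (j != i) else flag.

Hypothesis IH : forall d', (d' < d)%N -> @katchalski R k d'.
Hypothesis cS : forall i, i \in A -> cvx (S i).
Hypothesis Sa : forall i t, i \in A -> others i t -> S i (a t).
Hypothesis Sr : forall i t l, i \in A -> others i t -> ray (a t) (S i) (row l (C t)).
Hypothesis rC : forall j, j \in A -> (k <= \rank (C (Some j)))%N.
Hypothesis rN : flag -> (d + 2 - #|A| <= \rank (C None))%N.
Hypothesis nflag : ~~ flag -> (d + 2 <= #|A|)%N.
Hypothesis bigA : (2 * (d - k + 1) < #|A|)%N.
Hypothesis bad : ~ hascone k (fun x => forall i, i \in A -> S i x).

Context (u : J -> 'rV[R]_d) (c : J -> R).
Hypothesis deg : degenerate A others a C u c.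

(** A relative interior direction of the cone labelled [Some b]. *)
#[local] Definition axis b := \sum_l row l (C (Some b)).

(* A circuit [B] of the functionals, together with a convex combination [p] of
   points of the cones on which all of them are tight. *)
#[local] Lemma degenerate_circuit : exists (B : {set J}) (mu nu : J -> R),
  [/\ B \subset A, forall b, b \in B -> 0 < mu b,
      \sum_(b in B) mu b *: u b = 0, \sum_(b in B) mu b * c b = 0 &
  [/\ forall b, b \in B -> 0 <= nu b, \sum_(b in B) nu b = 1,
      forall i, i \in B ->
        \sum_(b in B) nu b * (dot (u i) (a (Some b) + axis b) - c i) = 0,
      (1 < #|B|)%N & (#|B| <= (\rank (spanm B u)).+1)%N]].
Proof.
have [uc u0 c0 [i1 i1A i1N]] := deg.
(* The bounds are included, so that the circuit is one of affine functionals. *)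
pose h i := lift1 (u i) (- c i).
pose X0 := [set i in A | h i != 0].
have X0A : X0 \subset A by apply/subsetP => i; rewrite inE => /andP[].
have i1X : i1 \in X0.
  rewrite inE i1A; apply: contraTneq i1N => hi1.
  have /lift1_inj[-> /eqP] : h i1 = lift1 0 0 by rewrite hi1 /lift1 raddf0 row_mx0.
  by rewrite oppr_eq0 => /eqP->; rewrite !eqxx.
have [||B [mu [BX B2 mu_gt0 mu0 Brk]]] :=
    @circuit R J (d + 1) X0 h (fun=> 1) i1 i1X (fun _ _ => ltr01).
- by move=> i; rewrite inE => /andP[].
- have : \sum_(i in A) 1 *: h i = 0.
    rewrite lift1_sum (eq_bigr u) => [|i _]; last by rewrite scale1r.
    rewrite u0; under eq_bigr do rewrite mul1r.
    by rewrite sumrN c0 oppr0 /lift1 raddf0 row_mx0.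
  rewrite (big_setID X0) /= (setIidPr X0A) [X in _ + X]big1 ?addr0// => i.
  rewrite !inE => /andP[+ iA]; rewrite iA /= negbK => /eqP->.
  exact: scaler0.
have BA : B \subset A := subset_trans BX X0A.
have [b0 b0B] : exists b, b \in B by apply/card_gt0P; apply: ltn_trans B2.
have [muu muc] : \sum_(b in B) mu b *: u b = 0 /\ \sum_(b in B) mu b * c b = 0.
  have : \sum_(b in B) mu b *: h b = lift1 0 0 by rewrite mu0 /lift1 raddf0 row_mx0.
  rewrite lift1_sum => /lift1_inj[-> c1]; split=> //.
  move: c1; under eq_bigr do rewrite mulrN.
  by rewrite sumrN => /eqP; rewrite oppr_eq0 => /eqP.
pose M i b := dot (u i) (a (Some b) + axis b) - c i.
have [|||nu [nu_ge0 nu1 nuM]] := zmatrix_right_kernel (M := M) (mu := mu) b0B.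
- move=> i b iB bB ib; have iA := subsetP BA i iB; have bA := subsetP BA b bB.
  have oib : others i (Some b) by rewrite /others bA eq_sym.
  have [u1 u2] := uc i (Some b) iA oib.
  rewrite /M dotDr addrAC -[leRHS]addr0 lerD ?subr_le0//.
  by rewrite dot_sumr sumr_le0.
- exact: mu_gt0.
- move=> b bB; rewrite /M; under eq_bigr do rewrite mulrBr -dotZl.
  by rewrite sumrB -dot_suml muu dot0l muc subr0.
exists B, mu, nu; split=> //; split=> //.
pose p := \sum_(b in B) nu b *: (a (Some b) + axis b).
have up i : i \in B -> dot (u i) p = c i.
  move=> /nuM; rewrite /M; under eq_bigr do rewrite mulrBr.
  rewrite sumrB -mulr_suml nu1 mul1r => /eqP; rewrite subr_eq0 => /eqP <-.
  by rewrite dot_sumr; apply: eq_bigr => b _; rewrite dotZr.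
(* On [B] the bound [c b] is [dot (u b) p], so the lifted normals are linear images of the normals
   and have no larger rank. *)
apply: (leq_trans Brk); rewrite ltnS.
apply: leq_trans (mxrankM_maxl (spanm B u) (row_mx 1%:M (- p^T))).
apply: mxrankS; apply/spanm_subP => b bB.
have -> : h b = u b *m row_mx 1%:M (- p^T).
  rewrite mul_mx_row mulmx1 mulmxN /h /lift1 -up// /dot raddfN /=.
  by rewrite -mx11_scalar.
by apply: submxMr; apply: spanm_mem.
Qed.

(** In the flat of [B] through [p], take a minimal [B'] whose sets contain no [k]-dimensional cone.
    Then [B] and [B'] cover [A], since the cone of an index outside both would lie in the flat and
    in all sets of [B']. By counting, the induction hypothesis leaves only its second alternative
    for [B']. *)
Lemma degenerate_absurd : False.
Proof.
have [B [mu [nu [BA mu_gt0 muu muc [nu_ge0 nu1 nuM B2 Brk]]]]] := degenerate_circuit.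
have [uc _ _ _] := deg.
set w := \rank (spanm B u) in Brk.
pose a' b := a (Some b) + axis b.
pose p := \sum_(b in B) nu b *: a' b.
have up i : i \in B -> dot (u i) p = c i.
  move=> /nuM; under eq_bigr do rewrite mulrBr.
  rewrite sumrB -mulr_suml nu1 mul1r => /eqP; rewrite subr_eq0 => /eqP <-.
  by rewrite dot_sumr; apply: eq_bigr => b _; rewrite dotZr.
have tight t : (forall b, b \in B -> others b t) -> forall b, b \in B ->
    dot (u b) (a t) = dot (u b) p /\ forall l, dot (u b) (row l (C t)) = 0.
  by move=> Bt b bB; rewrite up//; apply: (degenerate_tight deg BA mu_gt0).
have rk_tight t : (forall b, b \in B -> others b t) -> (\rank (C t) + w <= d)%N.
  by move=> Bt; apply: rank_orth => l b bB; apply: (tight t Bt b bB).2.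
have wd : (w <= d)%N by apply: rank_leq_col.
(* If [B] is all of [A], then [#|A| <= w + 1 <= d + 1], and the extra cone would have rank more than
   [d - w] although it is tight. *)
have [AB|/subsetPn[j jA jB]] := boolP (A \subset B).
  have := subset_leq_card AB.
  have [fl|/nflag] := boolP flag; last by move: Brk wd; lia.
  have := rk_tight None (fun _ _ => fl); have := rN fl; move: Brk; lia.
have otherB i (D : {set J}) : i \in A -> i \notin D ->
    forall b, b \in D -> others b (Some i).
  move=> iA iD b bD; rewrite /others iA /=.
  by apply: contraNneq iD => ->.
have kw : (k + w <= d)%N.
  by have := rk_tight _ (otherB j B jA jB); have := rC jA; lia.
pose S' i := @pull _ _ _ B u p (S i).
have fdE : flat_dim B u = (d - w)%N := flat_dimE B u.
pose P (D : {set J}) := `[< ~ hascone k (fun y => forall i, i \in D -> S' i y) >].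
have PA : P A.
  apply/asboolP => /(@hascone_push _ _ _ B u p k (fun x => forall i, i \in A -> S i x)).
  by move=> HA; apply: bad; apply: hasconeS HA => x [Sx _]; exact: Sx.
have [B' /minsetP[/asboolP PB' minB'] B'A] := minset_exists PA.
have {}PB' k' : (k' >= k)%N -> ~ hascone k'
    (fun x => (forall i, i \in B' -> S i x) /\
              forall b, b \in B -> dot (u b) x = dot (u b) p).
  move=> kk' /(hascone_le kk').
  by move=> /(@hascone_pull _ _ _ B u p k (fun x => forall i, i \in B' -> S i x)).
have cone_tight t : (forall b, b \in B -> others b t) ->
    (forall b, b \in B' -> others b t) -> hascone (\rank (C t))
      (fun x => (forall i, i \in B' -> S i x) /\
              forall b, b \in B -> dot (u b) x = dot (u b) p).
  move=> Bt B't; exists (a t), (C t); split=> // [|l e e_ge0].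
    split=> [i iB'|b bB]; last exact: (tight t Bt b bB).1.
    by apply: Sa; [exact: (subsetP B'A)|exact: B't].
  split=> [i iB'|b bB].
    by apply: Sr => //; [exact: (subsetP B'A)|exact: B't].
  by have [t1 t2] := tight t Bt b bB; rewrite dotDr dotZr t2 mulr0 addr0.
have ABB' : A \subset B :|: B'.
  apply/subsetP => i iA; rewrite inE; apply: contraT; rewrite negb_or.
  move=> /andP[iB iB']; exfalso.
  exact: PB' (rC iA) (cone_tight _ (otherB i B iA iB) (otherB i B' iA iB')).
have cABB' := leq_trans (subset_leq_card ABB') (leq_card_setU B B').
have [|||||B'1|[B'1 B'2]] := IH (d' := flat_dim B u) _ (A := B') (S := S').
- by rewrite fdE; move: B2 Brk wd; lia.
- by move=> i iB'; apply: cvx_pull; apply: cS; apply: (subsetP B'A).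
- by rewrite fdE; move: kw; lia.
- move=> i iB'; apply: contrapT => Hi.
  have := minB' (B' :\ i); rewrite subD1set => /(_ _ isT) E.
  have : i \in B' :\ i by rewrite E//; apply/asboolP.
  by rewrite !inE eqxx.
- move=> /(@hascone_push _ _ _ B u p k (fun x => forall i, i \in B' -> S i x)).
  exact: PB'.
- by move: B'1 bigA B2 Brk kw cABB'; rewrite fdE; lia.
have {}B'2 k' : (flat_dim B u + 2 - #|B'| <= k')%N -> ~ hascone k'
    (fun x => (forall i, i \in B' -> S i x) /\
              forall b, b \in B -> dot (u b) x = dot (u b) p).
  move=> kk' /(hascone_le kk').
  by move=> /(@hascone_pull _ _ _ B u p _ (fun x => forall i, i \in B' -> S i x)).
rewrite fdE in B'1 B'2.
(* An overlap lowers [#|A|] by one, and the extra cone then reaches the dimension excluded for [B']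
   in the flat. *)
have [dBB'|] := boolP [disjoint B & B']; last first.
  rewrite -setI_eq0 => BB'0.
  have : (#|A| < #|B| + #|B'|)%N.
    rewrite -cardsUI (leq_ltn_trans (subset_leq_card ABB'))//.
    by rewrite -[X in (X < _)%N]addn0 ltn_add2l card_gt0.
  have [fl|/nflag] := boolP flag; last by move: Brk B'1 wd; lia.
  have HN := cone_tight None (fun _ _ => fl) (fun _ _ => fl).
  have := rN fl => rN' ltA; apply: (B'2 _ _ HN).
  by move: rN' ltA Brk wd; lia.
have B'B i : i \in B' -> i \notin B.
  by move: dBB'; rewrite disjoint_sym disjoint_subset => /subsetP/(_ i).
(* The cone of [b] lies in every set except [S b]; for [b] in [B] it thus lies
   in all the sets of [B'].  Combining the apexes of these cones gives [p] in
   the flat, combining their axes a direction [v0] of the flat, interior to a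
   [k]-dimensional cone; so the sets of [B'] contain in the flat a cone of
   dimension [k - w]. *)
apply: (B'2 (k - w)%N); first by move: bigA kw cABB' Brk wd; lia.
pose B1 := [set b in B | 0 < nu b].
have B1B : B1 \subset B by apply/subsetP => b; rewrite inE => /andP[].
have axis_le0 i b : i \in B -> b \in B -> i != b -> dot (u i) (axis b) <= 0.
  move=> iB bB ib; rewrite dot_sumr sumr_le0// => l _.
  by apply: (uc i (Some b) _ _).2; rewrite /others ?(subsetP BA)// eq_sym.
(* For [i] outside the support of [nu], the tightness relation is a vanishing sum of nonpositive
   terms. *)
have axis0 i b : i \in B :\: B1 -> b \in B1 -> dot (u i) (axis b) = 0.
  rewrite !inE => /andP[iN iB] /andP[bB nub]; rewrite iB /= -leNgt in iN.
  have nui : nu i = 0 by apply/eqP; rewrite eq_le iN nu_ge0.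
  have ib : i != b by apply: contraTneq nub => <-; rewrite nui ltxx.
  have le0 b' : b' \in B -> i != b' -> dot (u i) (a (Some b')) - c i <= 0.
    move=> b'B ib'; rewrite subr_le0; apply: (uc i (Some b') _ _).1.
      exact: (subsetP BA).
    by rewrite /others (subsetP BA)//= eq_sym.
  have := nuM i iB; rewrite (big_setD1 i)//= nui mul0r add0r => /eqP.
  rewrite -oppr_eq0 -sumrN psumr_eq0 => [|b']; last first.
    rewrite !inE => /andP[b'i b'B]; rewrite oppr_ge0 mulr_ge0_le0 ?nu_ge0//.
    rewrite dotDr addrAC -[leRHS]addr0 lerD ?le0 ?axis_le0// 1?eq_sym//.
  move=> /allP/(_ b (mem_index_enum _)); rewrite !inE bB eq_sym ib oppr_eq0.
  rewrite mulf_eq0 gt_eqF//= dotDr => /eqP.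
  have := le0 b bB ib; have := axis_le0 i b iB bB ib; lra.
have [b1 b1B1] : exists b, b \in B1.
  apply: contrapT => nex; move/eqP: nu1; rewrite big1 ?(eq_sym 0) ?oner_eq0//.
  move=> b bB; apply/eqP; rewrite eq_le nu_ge0// andbT leNgt; apply/negP => nub.
  by apply: nex; exists b; rewrite inE bB.
have mu_gt01 b : b \in B1 -> 0 < mu b by move=> /(subsetP B1B); apply: mu_gt0.
(* The same kernel lemma, now for the axes alone, yields a combination of them parallel to the
   flat. *)
have [||th [th_ge0 th1 thM]] :=
  zmatrix_right_kernel (M := fun i b => dot (u i) (axis b)) b1B1 _ mu_gt01 _.
- by move=> i b /(subsetP B1B) iB /(subsetP B1B) bB; apply: axis_le0.
- move=> b bB1; transitivity (\sum_(i in B) mu i * dot (u i) (axis b)).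
    rewrite [RHS](big_setID B1) /= (setIidPr B1B) [X in _ = _ + X]big1 ?addr0//.
    by move=> i iB; rewrite axis0// mulr0.
  by under eq_bigr do rewrite -dotZl; rewrite -dot_suml muu dot0l.
pose v0 := \sum_(b in B1) th b *: axis b.
have uv0 i : i \in B -> dot (u i) v0 = 0.
  move=> iB; rewrite dot_sumr; have [iB1|iB1] := boolP (i \in B1).
    by rewrite -[RHS](thM i iB1); apply: eq_bigr => b _; rewrite dotZr.
  by apply: big1 => b bB1; rewrite dotZr axis0 ?mulr0// inE iB1.
have [b0 b0B1 thb0] : exists2 b, b \in B1 & 0 < th b.
  apply: contrapT => nex; move/eqP: th1; rewrite big1 ?(eq_sym 0) ?oner_eq0//.
  move=> b bB; apply/eqP; rewrite eq_le th_ge0// andbT leNgt; apply/negP => thb.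
  by apply: nex; exists b.
pose Y := (C (Some b0) :&: flat_mx B u)%MS.
have rY : (k - w <= \rank Y)%N.
  have b0A := subsetP BA b0 (subsetP B1B b0 b0B1).
  have rN' : \rank (flat_mx B u) = (d - w)%N.
    by rewrite -fdE; apply: (eqnP (row_base_free _)).
  have arith e f g s y q : (s <= f -> e <= q -> g <= f ->
      s + y = q + (f - g) -> e - g <= y)%N by clear; lia.
  apply: (arith k d w _ _ _ (rank_leq_col (C (Some b0) + flat_mx B u)%MS) (rC b0A) wd).
  by rewrite mxrank_sum_cap rN'.
have /submxP[Q QE] : (Y <= C (Some b0))%MS by apply: capmxSl.
(* Small enough for [v0 + ep *: row l Y] to keep nonnegative coefficients. *)
pose ep := th b0 / (1 + \sum_l \sum_i `|Q l i|).
have sQ_ge0 : 0 <= \sum_l \sum_i `|Q l i|.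
  by apply: sumr_ge0 => l _; apply: sumr_ge0 => i _; apply: normr_ge0.
have ep_gt0 : 0 < ep by rewrite divr_gt0// ltr_pwDl.
have epQ l i : 0 <= th b0 + ep * Q l i.
  have le1 : `|Q l i| <= 1 + \sum_l \sum_i `|Q l i|.
    rewrite (bigD1 l)//= (bigD1 i)//= addrCA -addrA lerDl.
    rewrite !addr_ge0 ?ler01 ?sumr_ge0// => l' _.
    by apply: sumr_ge0.
  have : ep * `|Q l i| <= th b0.
    rewrite /ep mulrAC ler_pdivrMr ?ltr_pwDl//.
    by rewrite ler_wpM2l// ltW.
  have : ep * - Q l i <= ep * `|Q l i| by rewrite ler_pM2l// -normrN ler_norm.
  by rewrite mulrN; lra.
have a'S i b : i \in B' -> b \in B -> S i (a' b) /\
    forall l, ray (a' b) (S i) (row l (C (Some b))).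
  move=> iB' bB; have iA := subsetP B'A i iB'.
  have oib : others i (Some b).
    rewrite /others (subsetP BA)//=; apply: contraNneq (B'B i iB') => <-.
    by [].
  have axr : ray (a (Some b)) (S i) (axis b).
    rewrite /axis (eq_bigr (fun l => 1 *: row l (C (Some b)))); last first.
      by move=> l _; rewrite scale1r.
    have Sai := Sa iA oib; have cSi := cS iA.
    by apply: ray_sum => // l _; apply: Sr.
  split; first by have := axr 1 ler01; rewrite scale1r.
  by move=> l; apply: ray_shift axr _; [exact: cS|exact: Sr].
have Sp i : i \in B' -> S i p.
  move=> iB'; apply: cvx_sum => // [|b bB]; last exact: (a'S i b iB' bB).1.
  by apply: cS; apply: (subsetP B'A).
have pray i b l : i \in B' -> b \in B1 -> ray p (S i) (row l (C (Some b))).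
  move=> iB'; rewrite inE => /andP[bB nub].
  apply: (ray_mix (t0 := b)) => // [|b' b'B|].
  - by apply: cS; apply: (subsetP B'A).
  - exact: (a'S i b' iB' b'B).1.
  - exact: (a'S i b iB' bB).2.
have combray i (f : J -> 'I_d -> R) : i \in B' ->
    (forall b l, b \in B1 -> 0 <= f b l) ->
    ray p (S i) (\sum_(b in B1) \sum_l f b l *: row l (C (Some b))).
  move=> iB' f_ge0; have cSi := cS (subsetP B'A i iB').
  apply: big_ind => [t _|v1 v2|b bB1].
  - by rewrite scaler0 addr0; apply: Sp.
  - exact: rayD.
  - by apply: ray_sum => // [|l _|l _]; [exact: Sp|exact: f_ge0|exact: pray].
pose M := col_mx v0 (\matrix_l (v0 + ep *: row l Y)).
have rM : (\rank Y <= \rank M)%N.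
  apply: mxrankS; apply/row_subP => l.
  have -> : row l Y = ep^-1 *: (row l (\matrix_l (v0 + ep *: row l Y)) - v0).
    by rewrite rowK addrAC subrr add0r scalerA mulVf ?scale1r// gt_eqF.
  apply: scalemx_sub; rewrite -addsmxE addmx_sub//.
    by apply: submx_trans (row_sub _ _) (addsmxSr _ _).
  by rewrite eqmx_opp addsmxSl.
apply: (@hasconeW _ _ _ _ p _ M); [by split|exact: leq_trans rM|].
move=> l.
suff [f f_ge0 [fE fu]] : exists2 f : J -> 'I_d -> R, forall b l, b \in B1 -> 0 <= f b l &
    row l M = \sum_(b in B1) \sum_l f b l *: row l (C (Some b)) /\
    forall b, b \in B -> dot (u b) (row l M) = 0.
  move=> t t_ge0; split=> [i iB'|b bB].
    by rewrite fE; apply: combray.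
  by rewrite dotDr dotZr fu// mulr0 addr0.
have v0E : v0 = \sum_(b in B1) \sum_l th b *: row l (C (Some b)).
  by apply: eq_bigr => b _; rewrite scaler_sumr.
have [{}l ->|{}l ->] := split_ordP l.
  exists (fun b _ => th b); first by move=> b _; apply: th_ge0.
  by rewrite rowKu [row _ _]row_id.
exists (fun b i => th b + (if b == b0 then ep * Q l i else 0)).
  move=> b i bB1; case: eqP => [->|_]; first exact: epQ.
  by rewrite addr0 th_ge0.
rewrite rowKd rowK; split=> [|b bB].
  under eq_bigr do under eq_bigr do rewrite scalerDl.
  under eq_bigr do rewrite big_split.
  rewrite big_split -v0E; congr (_ + _).
  rewrite (big_setD1 b0)//= eqxx [X in _ + X]big1 ?addr0; last first.
    move=> b; rewrite !inE => /andP[/negPf-> _].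
    by apply: big1 => i _; rewrite scale0r.
  rewrite [in LHS]QE row_mul mulmx_sum_row scaler_sumr; apply: eq_bigr => i _.
  by rewrite scalerA mxE.
rewrite dotDr uv0// dotZr add0r [X in _ * X](_ : _ = 0) ?mulr0//.
by have /flat_mxP := capmxSr (C (Some b0)) (flat_mx B u); apply.
Qed.

End Degenerate.

(** * Families of cones with a common relative interior point *)

Section Nondegenerate.
Context (R : realFieldType) (k d : nat) (J : finType) (A : {set J}).
Context (flag : bool) (C : option J -> 'M[R]_d).
Context (x : 'rV[R]_d).

Hypothesis rC : forall j, j \in A -> (k <= \rank (C (Some j)))%N.
Hypothesis bad : ~ hascone k (fun v => forall i, i \in A ->
  pos_cone (others A flag i) C v).
Hypothesis cx : common_point A (others A flag) (fun=> 0) C x.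

#[local] Definition cone_span i : 'M[R]_d :=
  (\sum_(t | others A flag i t) <<C t>>)%MS.

(** A large multiple of [x] absorbs every row of [Y] in all the cones at once, so [\rank Y >= k]
    would give them a common [k]-dimensional cone. *)
#[local] Lemma cone_span_small m (Y : 'M[R]_(m, d)) :
  (forall i, i \in A -> (Y <= cone_span i)%MS) -> (\rank Y < k)%N.
Proof.
move=> YL; rewrite ltnNge; apply/negP => kY; apply: bad.
have absorb i l : exists m0, i \in A -> 0 <= m0 /\
    forall M, m0 <= M -> pos_cone (others A flag i) C (M *: x + row l Y).
  have [iA|iA] := boolP (i \in A); last by exists 0.
  have [lam [co [_ co_gt0 _ xE]]] := cx iA.
  have {}xE : x = \sum_(t | others A flag i t) \sum_l co t l *: row l (C t).
    by rewrite xE; apply: eq_bigr => t _; rewrite scaler0 add0r.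
  have [m0 m0_ge0 Hm0] := pos_cone_absorb co_gt0 xE
    (submx_trans (row_sub l Y) (YL i iA)).
  by exists m0.
have /choice[m0 Hm0] : forall e : J * 'I_m, exists m0, e.1 \in A -> 0 <= m0 /\
    forall M, m0 <= M -> pos_cone (others A flag e.1) C (M *: x + row e.2 Y).
  by case=> i l; apply: absorb.
pose M := \sum_(e | e.1 \in A) m0 e.
have HM i l : i \in A -> pos_cone (others A flag i) C (M *: x + row l Y).
  move=> iA; apply: (Hm0 (i, l) iA).2; rewrite /M (bigD1 (i, l))//= lerDl.
  by apply: sumr_ge0 => e /andP[eA _]; apply: (Hm0 e eA).1.
have xP i : i \in A -> pos_cone (others A flag i) C x.
  move=> iA; have [lam [co [_ co_gt0 _ xE]]] := cx iA.
  exists (fun t l => if others A flag i t then co t l else 0) => [t l|].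
    by case: ifP => // it; apply/ltW/co_gt0.
  by rewrite xE; apply: eq_bigr => t ->; rewrite scaler0 add0r.
pose Z := col_mx x (\matrix_l (M *: x + row l Y)).
have rZ : (\rank Y <= \rank Z)%N.
  apply: mxrankS; apply/row_subP => l.
  have -> : row l Y = row l (\matrix_l (M *: x + row l Y)) - M *: x.
    by rewrite rowK addrAC subrr add0r.
  rewrite -addsmxE addmx_sub//.
    by apply: submx_trans (row_sub _ _) (addsmxSr _ _).
  by rewrite eqmx_opp scalemx_sub// addsmxSl.
apply: (@hasconeW _ _ _ _ 0 _ Z); [|exact: leq_trans rZ|].
  by move=> i iA; apply: pos_cone0.
move=> l t t_ge0 i iA; rewrite add0r; apply: pos_coneZ => //.
have [{}l ->|{}l ->] := split_ordP l.
  by rewrite rowKu [row _ _]row_id; apply: xP.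
by rewrite rowKd rowK; apply: HM.
Qed.

(* Each new subspace [cone_span j] strictly cuts the intersection of the
   previous ones, by minimality. *)
#[local] Lemma cone_span_count (W : {set J}) : W \subset A ->
  (#|W| + \rank (\bigcap_(i in W) cone_span i)%MS <= d)%N.
Proof.
have [n] := ubnP #|W|; elim: n => // n IHn in W * => /ltnSE-leWn WA.
have [->|[j jW]] := set_0Vmem W.
  by rewrite cards0 big_set0 mxrank1.
have W'n : (#|W :\ j| < n)%N by move: leWn; rewrite (cardsD1 j) jW.
have W'A : W :\ j \subset A by apply: subset_trans WA; apply: subD1set.
rewrite (cardsD1 j) jW add1n addSn.
apply: leq_trans (IHn _ W'n W'A); rewrite -addnS leq_add2l (big_setD1 j)//=.
set Q := (\bigcap_(i in _) _)%MS.
apply: rank_ltmx; rewrite ltmxE capmxSr /=; apply/negP => QL.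
have jA := subsetP WA j jW.
have := rC jA; apply/negP; rewrite -ltnNge; apply: cone_span_small => i iA.
have CL i' : i' \in A -> i' != j -> (C (Some j) <= cone_span i')%MS.
  move=> i'A i'j; rewrite /cone_span (sumsmx_sup (Some j)) ?genmxE//.
  by rewrite /others jA eq_sym.
have [->|ij] := eqVneq i j; last exact: CL.
apply: submx_trans (submx_trans QL (capmxSl _ _)); apply/sub_bigcapmxP => i'.
by rewrite !inE => /andP[i'j i'W]; apply: CL => //; apply: (subsetP WA).
Qed.

(** One index [j] is left out of the count: all the other spans contain the cone of [j], so their
    intersection has rank at least [k]. *)
Lemma nondegenerate_card : A != finset.set0 -> (#|A| <= d - k + 1)%N.
Proof.
move=> /set0Pn[j jA].
have := cone_span_count (subD1set A j).
have : (k <= \rank (\bigcap_(i in A :\ j) cone_span i)%MS)%N.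
  apply: leq_trans (rC jA) _; apply: mxrankS; apply/sub_bigcapmxP => i.
  rewrite !inE => /andP[ij iA]; rewrite /cone_span (sumsmx_sup (Some j)) ?genmxE//.
  by rewrite /others jA eq_sym.
by rewrite [#|A|](cardsD1 j) jA; lia.
Qed.

End Nondegenerate.

(** Since [degenerate_absurd] excludes separated hulls, these have a common point, which reduces the
    question to cones of directions. Those are not separated either, and with a common point the
    family is too small. *)
Lemma katchalski_cones (R : realFieldType) (k d : nat) : @katchalski R k d.
Proof.
have [n] := ubnP d; elim: n => // n IHn in d * => /ltnSE-dn.
move=> J A S cS kd Hmin bad.
have [|bigA] := leqP #|A| (2 * (d - k + 1)); first by left.
have [|nbig] := pselect ((#|A| <= d + 1)%N /\
  ~ hascone (d + 2 - #|A|) (fun x => forall i, i \in A -> S i x)); first by right.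
exfalso.
have IH d' : (d' < d)%N -> @katchalski R k d'.
  by move=> d'd; apply: IHn; apply: leq_trans dn.
(* In this range the failure of the second alternative supplies a common cone of dimension
   [d + 2 - #|A|]. *)
pose flag := (#|A| <= d + 1)%N.
have /choice[a0 /choice[C0 HC0]] : forall t : option J, exists a (C : 'M[R]_d),
   (forall i, i \in A -> others A flag i t ->
      S i a /\ forall l, ray a (S i) (row l C)) /\
   (match t with
    | Some j => j \in A -> (k <= \rank C)%N
    | None => flag -> (d + 2 - #|A| <= \rank C)%N end).
  case=> [j|].
    have [jA|jA] := boolP (j \in A); last first.
      by exists 0, 0; split=> // i iA; rewrite /= (negPf jA).
    have [p [C [Sp rC Cp]]] := Hmin j jA.
    exists p, C; split=> // i iA /andP[_ ji].
    have iAj : i \in A :\ j by rewrite !inE eq_sym ji.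
    by split=> [|l t t_ge0]; [exact: Sp|exact: Cp].
  have [fl|fl] := boolP flag; last by exists 0, 0.
  have [p [C [Sp rC Cp]]] : hascone (d + 2 - #|A|) (fun x => forall i, i \in A -> S i x).
    by apply: contrapT => nH; apply: nbig.
  exists p, C; split=> // i iA _.
  by split=> [|l t t_ge0]; [exact: Sp|exact: Cp].
have Sa i t : i \in A -> others A flag i t -> S i (a0 t).
  by move=> iA it; have [/(_ i iA it)[]] := HC0 t.
have Sr i t l : i \in A -> others A flag i t -> ray (a0 t) (S i) (row l (C0 t)).
  by move=> iA it; have [/(_ i iA it)[_]] := HC0 t.
have rC j : j \in A -> (k <= \rank (C0 (Some j)))%N by have [_] := HC0 (Some j).
have rN : flag -> (d + 2 - #|A| <= \rank (C0 None))%N by have [_] := HC0 None.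
have nflag : ~~ flag -> (d + 2 <= #|A|)%N by rewrite /flag; lia.
have [i0 i0A] : exists i, i \in A by apply/card_gt0P; lia.
have A0 : A != finset.set0 by apply/set0Pn; exists i0.
have [j0 i0j0] : exists j, others A flag i0 (Some j).
  have : (0 < #|A :\ i0|)%N by move: bigA; rewrite (cardsD1 i0) i0A; lia.
  by move=> /card_gt0P[j]; rewrite !inE => /andP[ji jA]; exists j; rewrite /= jA.
have [[x cx]|[u [c deg]]] :=
  @common_point_alternative R d _ _ A (others A flag) a0 C0 i0 (Some j0) i0A i0j0;
  last by have := degenerate_absurd IH cS Sa Sr rC rN nflag bigA bad deg.
pose Rc i := pos_cone (others A flag i) C0.
(* A [k]-dimensional cone in all the [Rc i], whatever its apex, could be moved to the common point
   [x]. *)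
have badR : ~ hascone k (fun v => forall i, i \in A -> Rc i v).
  move=> [q [M [_ kM Mq]]]; apply: bad.
  have Sx i : i \in A -> S i x /\
      forall t l, others A flag i t -> ray x (S i) (row l (C0 t)).
    by move=> iA; apply: (common_point_ray cx iA) => // [|t|t l]; auto.
  apply: (@hasconeW _ _ _ _ x _ M) => // [i iA|l t t_ge0 i iA].
    exact: (Sx i iA).1.
  have [Six rSi] := Sx i iA; apply: (pos_cone_ray (cS i iA) Six rSi) => //.
  by apply: (@pos_cone_closed _ _ _ _ _ q) => e e_ge0; apply: (Mq l e e_ge0).
have [[x' cx']|[u [c deg]]] := @common_point_alternative R d _ _ A (others A flag)
    (fun=> 0) C0 i0 (Some j0) i0A i0j0.
  by have := nondegenerate_card rC badR cx' A0; move: bigA; lia.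
apply: (degenerate_absurd IH _ _ _ rC rN nflag bigA badR deg) => [i iA|i t iA it|i t l iA it].
- exact: cvx_pos_cone.
- exact: pos_cone0.
- move=> e e_ge0; rewrite add0r; apply: pos_coneZ => //.
  exact: pos_cone_row.
Qed.

Local Open Scope classical_set_scope.
Local Open Scope ring_scope.

(** * The theorem *)

Lemma row_free_subrows (R : fieldType) (m n k : nat) (M : 'M[R]_(m, n)) :
  (k <= \rank M)%N -> exists f : 'I_k -> 'I_m, row_free (rowsub f M).
Proof.
move=> kM; pose g := maxrankfun M; pose w : 'I_k -> 'I_(\rank M) := widen_ord kM.
exists (g \o w); have /row_freeP[B gB] := maxrowsub_free M.
apply/row_freeP; exists (colsub w B).
have -> : rowsub (g \o w) M = rowsub w (rowsub g M).
  by apply/matrixP => i j; rewrite !mxE.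
rewrite -mxsub_mul gB; apply/matrixP => i j; rewrite !mxE.
by rewrite (inj_eq (_ : injective w))// => x y /(congr1 val)/= /val_inj.
Qed.

Lemma free_row_free (R : fieldType) (k d : nat) (X : k.-tuple 'rV[R]_d) :
  free X = row_free (\matrix_(l < k) tnth X l).
Proof.
have combE (v : 'rV_k) : v *m (\matrix_(l < k) tnth X l) = \sum_(i < k) v 0 i *: X`_i.
  rewrite mulmx_sum_row; apply: eq_bigr => i _.
  by rewrite rowK (tnth_nth 0).
apply/idP/idP => [/freeP fX|fX].
  apply: inj_row_free => v; rewrite combE => /fX v0.
  by apply/rowP => i; rewrite v0 mxE.
apply/freeP => c c0 i; pose v : 'rV_k := \row_i c i.
have : v *m (\matrix_(l < k) tnth X l) = 0.
  by rewrite combE -[RHS]c0; apply: eq_bigr => j _; rewrite mxE.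
rewrite -(mul0mx _ (\matrix_(l < k) tnth X l)) => /(row_free_inj fX)/rowP/(_ i).
by rewrite !mxE.
Qed.

Lemma contains_cone_hascone (R : realType) (d k : nat) (S : set 'rV[R]_d) :
  contains_cone k S -> hascone k S.
Proof.
move=> [_ [a [A [-> [U UA <-]]]] AS].
have [m [M [MA AM]]] := spanning_rows A.
apply: (@hasconeW _ _ _ _ a _ M).
- apply: AS; exists 0; rewrite ?addr0//.
  by exists 0%N, (fun=> 0), (fun=> 0); split=> [[]|[]|]//; rewrite big_ord0.
- pose X := vbasis U; have := vbasisP U => /andP[_].
  rewrite free_row_free -row_leq_rank => kX; apply: leq_trans kX _.
  apply: mxrankS; apply/row_subP => l; rewrite rowK.
  have : [set` U] (tnth (vbasis U) l) by apply: vbasis_mem; apply: mem_tnth.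
  rewrite UA => -[n [c [v [Av ->]]]].
  by apply: summx_sub => i _; apply: scalemx_sub; apply: AM.
- move=> l t t_ge0; apply: AS; exists (t *: row l M) => //.
  exists 1%N, (fun=> t), (fun=> row l M); split=> //.
  by rewrite big_ord1.
Qed.

(** The rank in [hascone] is only bounded below; keeping [k] independent rows makes the dimension
    exactly [k]. *)
Lemma hascone_contains_cone (R : realType) (d k : nat) (S : set 'rV[R]_d) :
  cvx S -> hascone k S -> contains_cone k S.
Proof.
move=> cS [p [C [Sp kC pC]]].
have [f fC] := row_free_subrows kC; set M := rowsub f C in fC.
pose A : set 'rV[R]_d := [set v | exists l, v = row l M].
have pA v : A v -> ray p S v.
  by move=> [l ->]; rewrite row_rowsub; apply: pC.
exists [set p + x | x in pos_hull A]; last first.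
  move=> _ [_ [n [c [v [c_ge0 Av ->]]]] <-].
  have : ray p S (\sum_(i < n) c i *: v i).
    by apply: ray_sum => // i _; apply: pA.
  by move=> /(_ 1 ler01); rewrite scale1r.
exists p, A; split=> //.
pose X := [tuple row l M | l < k].
have XM : \matrix_(l < k) tnth X l = M.
  by apply/row_matrixP => l; rewrite rowK tnth_mktuple.
have fX : free X by rewrite free_row_free XM.
exists <<X>>%VS; last by rewrite (eqP fX) size_tuple.
apply/seteqP; split=> v.
  move=> vX; exists k, (fun i => coord X i v), (tnth X).
  split=> [i|]; first by exists i; rewrite tnth_mktuple.
  rewrite [LHS](@coord_span _ _ _ X v vX); apply: eq_bigr => i _.
  by rewrite -tnth_nth.
move=> [n [c [w [Aw ->]]]] /=; apply: memv_suml => i _; apply: memvZ.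
have [l ->] := Aw i; apply: memv_span.
by apply/mapP; exists l; rewrite ?mem_enum.
Qed.

Lemma convex_set_cvx (R : realType) (d : nat) (S : set 'rV[R]_d) :
  convex_set S -> cvx S.
Proof.
move=> cS x y t Sx Sy /andP[t0 t1].
exact: set_mem (cS x y (Itv01 t0 t1) (mem_set Sx) (mem_set Sy)).
Qed.

Theorem theorem1p3 (R : realType) (d k : nat)
    (F : 'I_(2 * d - k + 1) -> set (set 'rV[R]_d)) :
  (2 <= d)%N -> (1 <= k <= d - 1)%N ->
  (forall i, finite_set (F i)) ->
  (forall i S, F i S -> convex_set S) ->
  (forall (J : {set 'I_(2 * d - k + 1)})
          (G : 'I_(2 * d - k + 1) -> set 'rV[R]_d),
     (#|J| <= maxn (d + 1) (2 * (d - k + 1)))%N ->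
     (forall j, j \in J -> F j (G j)) ->
     contains_cone k (\bigcap_(j in [set` J]) G j)) ->
  exists i, contains_cone k (\bigcap_(S in F i) S).
Proof.
move=> d2 /andP[k1 kd] finF cF HF.
have cF' i S : F i S -> cvx S by move=> FS; apply: convex_set_cvx; apply: cF FS.
have cbig (T : Type) (D : set T) (G : T -> set 'rV[R]_d) :
    (forall t, D t -> cvx (G t)) -> cvx (\bigcap_(t in D) G t).
  by move=> cG x y t xG yG t01 s Ds; apply: cG => //; [exact: xG|exact: yG].
have conv i : hascone k (\bigcap_(S in F i) S) ->
    exists i, contains_cone k (\bigcap_(S in F i) S).
  move=> Hi; exists i; apply: hascone_contains_cone => //.
  by apply: cbig => S; apply: cF'.
(* An empty family has the whole space as intersection, which contains a cone because [k <= d]. *)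
have [[i Fi0]|/forallNP F0] := pselect (exists i, F i = classical_sets.set0).
  apply: (conv i); rewrite Fi0 bigcap_set0.
  by exists 0, 1%:M; split=> //; rewrite mxrank1; lia.
have /choice[s Fs] : forall i, exists s : seq (set 'rV[R]_d), F i = [set` s].
  by move=> i; apply/finite_seqP.
have /choice[S0 FS0] : forall i, exists S, F i S.
  by move=> i; apply/classical_sets.set0P/eqP/F0.
(* All families are enumerated by one index type; past the end of [s i] the member [S0 i] is
   repeated. *)
pose m := \max_i size (s i).
pose G i (j : 'I_m.+1) := nth (S0 i) (s i) j.
have FG i j : F i (G i j).
  rewrite /G; have [js|sj] := ltnP j (size (s i)); last by rewrite nth_default.
  by rewrite Fs /=; apply: mem_nth.
have GF i S : F i S -> exists j, S = G i j.
  rewrite [X in X S](Fs i) /= => Ss.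
  have lt_m : (index S (s i) < m.+1)%N.
    rewrite ltnS (leq_trans (index_size _ _))//.
    exact: (@leq_bigmax _ (fun i => size (s i)) i).
  by exists (Ordinal lt_m); rewrite /G /= nth_index.
pose A := [set: 'I_(2 * d - k + 1)]%SET.
have [Hall|/existsNP[sg bad]] := pselect (forall sg : {ffun 'I_(2 * d - k + 1) -> 'I_m.+1},
    hascone k (fun x => forall i, i \in A -> G i (sg i) x)).
  have [||i _ Hi] := colourful_cones ord0 _ _ Hall.
  - by move=> i j _; apply: (cF' i).
  - by rewrite cardsT card_ord; lia.
  - apply: (conv i); apply: hasconeS Hi => x Gx S FS.
    by have [j ->] := GF i S FS.
exfalso.
(* A minimal part of a rainbow without a cone is small by [katchalski_cones], so the hypothesis on
   rainbow sub-selections applies to it. *)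
pose P (D : {set 'I_(2 * d - k + 1)}) :=
  `[< ~ hascone k (fun x => forall i, i \in D -> G i (sg i) x) >].
have PA : P A by apply/asboolP.
have [D /minsetP[/asboolP badD minD] _] := minset_exists PA.
have Dm : (#|D| <= maxn (d + 1) (2 * (d - k + 1)))%N.
  have [||||D1|[D1 _]] := @katchalski_cones R k d _ D (fun i => G i (sg i)).
  - by move=> i _; apply: (cF' i).
  - by lia.
  - move=> i iD; apply: contrapT => Hi.
    have := minD (D :\ i)%SET; rewrite subD1set => /(_ _ isT) E.
    have : i \in (D :\ i)%SET by rewrite E//; apply/asboolP.
    by rewrite !inE eqxx.
  - exact: badD.
  - by rewrite leq_max D1 orbT.
  - by rewrite leq_max D1.
apply: badD.
have /contains_cone_hascone := HF D (fun i => G i (sg i)) Dm (fun i _ => FG i (sg i)).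
by apply: hasconeS => x Dx i iD; apply: Dx.
Qed.
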